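(* Assume (A), (B), (V), (W), (g), (G) and (h), with $$0<l_j<\frac4N\ (1\le j\le m),\qquad \mu<2-\frac1q+\frac2N,\qquad \inf_{x\in\mathbb R^N}V(x)>0.$$ Let $M>0$, let $\Phi^0\in\mathcal H^1_A$ be such that $\|\Phi^0\|_{\mathcal H^1_A}\le M$, and let $$\Phi\in C\big((-T_*(\Phi^0),T^*(\Phi^0)),\mathcal H^1_A\big)\cap C^1\big((-T_*(\Phi^0),T^*(\Phi^0)),\mathcal H'_A\big)$$ be the maximal solution of $$\mathrm{i}\,\partial_t\Phi-L_A\Phi+\tilde g(\Phi)=0,\qquad \Phi(0)=\Phi^0. \tag{CP}$$ Then $\Phi$ is global, namely $T_*(\Phi^0)=T^*(\Phi^0)=\infty$, and $\sup\{\|\Phi(t)\|_{\mathcal H^1_A}:t\in\mathbb R\}<\infty$.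
   Context: Spaces. $N,m\ge1$ are integers; $A:\mathbb R^N\to\mathbb R^N$; $Du=\mathrm i^{-1}\nabla u-A(x)u$. $H^1_A$ is the closure of $C_c^\infty(\mathbb R^N;\mathbb C)$ under $(u,v)_{H^1_A}=\mathrm{Re}\int (Du\cdot\overline{Dv}+u\bar v)\,dx$; $\mathcal H^1_A=(H^1_A)^m$ with $\|\Phi\|_{\mathcal H^1_A}^2=\sum_j(\|D\Phi_j\|_{L^2}^2+\|\Phi_j\|_{L^2}^2)$; $\mathcal H'_A$ is its dual; $\mathcal L^p=(L^p(\mathbb R^N;\mathbb C))^m$ with $\|\Phi\|_{\mathcal L^p}^2=\sum_j\|\Phi_j\|_{L^p}^2$. Dualities are taken with respect to the real pairing $\mathrm{Re}\sum_j\int\Phi_j\overline{\Psi_j}$. $L_A=(\frac{\nabla}{\mathrm i}-A(x))^2$, acting componentwise $\mathcal H^1_A\to\mathcal H'_A$. $L^q_w(\mathbb R^N)$ is the weak $L^q$ space. Data. $V:\mathbb R^N\to\mathbb R$; $g_j:(0,\infty)\times[0,\infty)^m\to\mathbb R$; $W_{ij}:[0,\infty)\to[0,\infty)$; $h:[0,\infty)\to[0,\infty)$. $G:(0,\infty)\times[0,\infty)^m\to\mathbb R$ is measurable in $r$ (off a null set) and continuous in each $s_j$, with $\partial G/\partial s_j(r,s)=\frac12 g_j(r,s)$. Maps. For $1\le j\le m$: $\tilde g_{1,j}(\Phi)=V\Phi_j$, $\tilde g_{2,j}(\Phi)=g_j(|x|,|\Phi_1|^2,\dots,|\Phi_m|^2)\Phi_j$,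 $\tilde g_{3,j}(\Phi)=\sum_{i=1}^m \big(W_{ij}(|\cdot|)*h(|\Phi_i|)\big)\frac{h'(|\Phi_j|)}{|\Phi_j|}\Phi_j$ (the last factor $\frac{h'(|z|)}{|z|}z$ being $0$ at $z=0$), and $\tilde g=-\tilde g_1+\tilde g_2+\tilde g_3$. Assumptions. (A) $A\in C^\infty(\mathbb R^N,\mathbb R^N)$ and for all multi-indices $|\alpha|\ge1$, $\sup_x|\partial_x^\alpha A|\le C_\alpha$. (B) There is $\varepsilon>0$ such that for all $|\alpha|\ge1$ and $x$, $|\partial_x^\alpha B(x)|\le C_\alpha\langle x\rangle^{-1-\varepsilon}$, where $B=(\partial_iA_j-\partial_jA_i)_{i,j}$ and $\langle x\rangle=(1+|x|^2)^{1/2}$. (V) $V\in L^p(\mathbb R^N,\mathbb R)$ or $V\in L^p+L^\infty$ for some $p\ge1$, $p\ge N/2$. (W) $W_{ij}$ is non-increasing (and extended evenly), $W_{ij}(|x|)\in L^q_w(\mathbb R^N)$ with $q>\max\{1,N/4\}$, and $W_{ij}=W_{ji}$. (g) The functions $f_j(x,\Phi)=g_j(|x|,|\Phi_1|^2,\dots,|\Phi_m|^2)\Phi_j$ are measurable in $x$ and continuous in $\Phi\in\mathbb C^m$ for a.e. $x$, and there are $C>0$ and $\alpha\in[0,\frac4{N-2})$ ($\alpha\in[0,\infty)$ if $N\le2$) with $|f_j(x,\Psi)-f_j(x,\Phi)|\le C(|\Phi|^\alpha+|\Psi|^\alpha)|\Psi-\Phi|$ for a.e. $x$ and all $\Phi,\Psi\in\mathbb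 C^m$. (G) There are $K>0$ and exponents $l_1,\dots,l_m$ such that for all $r>0$ and $s_1,\dots,s_m\ge0$, $0\le G(r,s_1,\dots,s_m)\le K\big(\sum_j s_j+\sum_j s_j^{(l_j+2)/2}\big)$ (in the theorem, $0<l_j<4/N$). (h) $h$ is $C^1$, non-decreasing, $h(0)=0$, twice differentiable on $(0,\infty)$, and there are $C,D,E>0$ with $h(s)\le Cs^\mu$, $|h'(s)|\le Ds^{\mu-1}$, $|h''(s)|\le Es^{\mu-2}$, where $2\le\mu\le\frac{6q-1}{2q}-\frac{N-2}{N}$. Energy. $F_A(\Phi)=\frac12\sum_j\int|D\Phi_j|^2dx+\frac12\int V|\Phi|^2dx-\int G(|x|,|\Phi_1|^2,\dots,|\Phi_m|^2)dx-\frac12\sum_{i,j}\iint W_{ij}(|x-y|)h(|\Phi_i(x)|)h(|\Phi_j(y)|)\,dx\,dy$, so that $F_A'(\Phi)=L_A\Phi-\tilde g(\Phi)$. Maximal solution. Under (A), (B), (V), (W), (g), (h), for each $\Phi^0\in\mathcal H^1_A$ there are $T_*(\Phi^0),T^*(\Phi^0)\in(0,\infty]$ and a unique solution $\Phi$ of (CP) (equation understood in $\mathcal H'_A$) in the class written in the claim, which is maximal: if $T^*(\Phi^0)<\infty$ (resp. $T_*(\Phi^0)<\infty$) then $\|\Phi(t)\|_{\mathcal H^1_A}\to\infty$ as $t\uparrow T^*(\Phi^0)$ (resp. $t\downarrow-T_*(\Phi^0)$); moreover $\|\Phi(t)\|_{\mathcal L^2}=\|\Phi^0\|_{\mathcal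 L^2}$ and $F_A(\Phi(t))=F_A(\Phi^0)$ for all $t$ in the interval of existence. This is the maximal solution referred to in the claim. *)

(* Defs.v *)
From HB Require Import structures.
From mathcomp Require Import all_boot all_order all_algebra.
From mathcomp Require Import complex.
From mathcomp Require Import all_classical all_reals all_analysis.

Set Implicit Arguments.
Unset Strict Implicit.
Unset Printing Implicit Defensive.

Import Order.TTheory GRing.Theory Num.Theory.
Import numFieldNormedType.Exports.

Local Open Scope classical_set_scope.
Local Open Scope ring_scope.

Definition measure_rV_display : measure_display -> measure_display.
Proof. exact. Qed.

Section measurable_rV.
Context {R : realType}.
Variable n : nat.

Let coors : 'I_n -> 'rV[R]_n -> measurableTypeR R := fun i x => x ord0 i.

Let rV_set0 : g_sigma_preimage coors set0.
Proof. exact: sigma_algebra0. Qed.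

Let rV_setC A : g_sigma_preimage coors A -> g_sigma_preimage coors (~` A).
Proof. exact: sigma_algebraC. Qed.

Let rV_bigcup (F : _^nat) : (forall i, g_sigma_preimage coors (F i)) ->
  g_sigma_preimage coors (\bigcup_i (F i)).
Proof. exact: sigma_algebra_bigcup. Qed.

HB.instance Definition _ :=
  @isMeasurable.Build (measure_rV_display default_measure_display)
    'rV[R]_n (g_sigma_preimage coors) rV_set0 rV_setC rV_bigcup.

End measurable_rV.

Section lebesgue_rV.
Context {R : realType}.

Lemma measurable_coord n (i : 'I_n) :
  measurable_fun [set: 'rV[R]_n]
    (fun x : 'rV[R]_n => x ord0 i : measurableTypeR R).
Proof.
move=> _ Y mY; rewrite setTI; apply: sub_sigma_algebra => /=.
rewrite -bigcup_seq/=; exists i => /=; first by rewrite mem_index_enum.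
by exists Y => //; rewrite setTI.
Qed.

Lemma measurable_fun_rV d (T : measurableType d) n (f : T -> 'rV[R]_n) :
  (forall i, measurable_fun [set: T]
     (fun x => f x ord0 i : measurableTypeR R)) ->
  measurable_fun [set: T] f.
Proof.
move=> mf.
suff prefS : g_sigma_preimage
    (fun i => (fun x : 'rV[R]_n => x ord0 i : measurableTypeR R) \o f)
    `<=` measurable.
  move=> _ A mA; apply: prefS; rewrite g_sigma_preimage_comp.
  by exists A.
apply: smallest_sub; first exact: sigma_algebra_measurable.
rewrite -bigcup_seq; apply: bigcup_sub => i _ A [B mB <-].
exact: mf.
Qed.

Definition rV_cons n (p : measurableTypeR R * 'rV[R]_n) : 'rV[R]_n.+1 :=
  row_mx (p.1%:M : 'rV_1) p.2.

Lemma rV_cons0 n (p : measurableTypeR R * 'rV[R]_n) :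
  rV_cons p ord0 ord0 = p.1.
Proof.
rewrite [LHS](_ : _ = (row_mx (p.1%:M : 'rV_1) p.2) ord0 (lshift n ord0)).
  by rewrite row_mxEl mxE eqxx mulr1n.
by congr (row_mx _ _ _ _); exact/val_inj.
Qed.

Lemma rV_consS n (p : measurableTypeR R * 'rV[R]_n) (j : 'I_n) :
  rV_cons p ord0 (lift ord0 j) = p.2 ord0 j.
Proof.
rewrite [LHS](_ : _ = (row_mx (p.1%:M : 'rV_1) p.2) ord0 (rshift 1 j)).
  by rewrite row_mxEr.
by congr (row_mx _ _ _ _); exact/val_inj.
Qed.

Lemma measurable_rV_cons n : measurable_fun setT (@rV_cons n).
Proof.
apply: measurable_fun_rV => i.
case: (unliftP ord0 i) => [j|] ->.
  under eq_fun => x do rewrite rV_consS.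
  by apply: (measurableT_comp (measurable_coord j)); exact: measurable_snd.
under eq_fun => x do rewrite rV_cons0.
exact: measurable_fst.
Qed.

Lemma rV_cons_sigma_finite n (m : {sigma_finite_measure set 'rV[R]_n -> \bar R}) :
  sigma_finite setT (pushforward (lebesgue_measure \x m)%E (@rV_cons n)).
Proof.
pose uncons (x : 'rV[R]_n.+1) : measurableTypeR R * 'rV[R]_n :=
  (x ord0 ord0, \row_j x ord0 (lift ord0 j)).
have unconsK p : uncons (rV_cons p) = p.
  case: p => a b; congr pair; first exact: rV_cons0.
  by apply/rowP => j; rewrite mxE rV_consS.
have muncons : measurable_fun setT uncons.
  apply/measurable_fun_pairP; split; first exact: measurable_coord.
  apply: measurable_fun_rV => i.
  under eq_fun => x do rewrite /= mxE.
  exact: measurable_coord.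
have [F [FT Foo]] : exists F : (set (measurableTypeR R * 'rV[R]_n))^nat,
    setT = \bigcup_i F i /\ forall i, measurable (F i) /\
    ((lebesgue_measure \x m)%E (F i) < +oo)%E.
  have /sigma_finiteP[F [TF ndF Foo]] :=
    sigma_finiteT (@lebesgue_measure R : {sigma_finite_measure set _ -> \bar R}).
  have /sigma_finiteP[G [TG ndG Goo]] := sigma_finiteT m.
  exists (fun n => F n `*` G n); split.
    rewrite -setXTT TF TG; apply/seteqP; split.
      move=> [x y] [/= [a _ Fa] [b _ Gb]]; exists (maxn a b) => //; split => /=.
        by have /subsetPset := ndF _ _ (leq_maxl a b); apply.
      by have /subsetPset := ndG _ _ (leq_maxr a b); apply.
    by move=> [x y] [a _ [/= Fa Ga]]; split; exists a.
  move=> i; have [mF Fi] := Foo i; have [mG Gi] := Goo i.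
  split; first exact: measurableX.
  by rewrite product_measure1E// lte_mul_pinfty// ge0_fin_numE.
exists (fun i => uncons @^-1` F i).
  by rewrite -preimage_bigcup -FT preimage_setT.
move=> i; have [mF Fi] := Foo i; split.
  by rewrite -[X in measurable X]setTI; exact: muncons.
rewrite /pushforward -comp_preimage (_ : uncons \o _ = id) ?preimage_id//.
by apply/funext => p /=.
Qed.

Section step.
Variables (n : nat) (m : {sigma_finite_measure set 'rV[R]_n -> \bar R}).

Definition leb_step := pushforward (lebesgue_measure \x m)%E (@rV_cons n).

Let pfm : {measure set 'rV[R]_n.+1 -> \bar R} :=
  measure_function_pushforward__canonical__measure_function_Measure
    (lebesgue_measure \x m)%E (@measurable_rV_cons n).

HB.instance Definition _ := isMeasure.Build _ _ _ leb_step
  (measure0 pfm) (measure_ge0 pfm) (@measure_semi_sigma_additive _ _ _ pfm).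

Let leb_step_sigma_finite : sigma_finite setT leb_step.
Proof. exact: rV_cons_sigma_finite. Qed.

Let leb_step_sfinite : sfinite_measure leb_step.
Proof. exact: sfinite_measure_sigma_finite. Qed.

HB.instance Definition _ := @isSFinite.Build _ _ _ leb_step leb_step_sfinite.
HB.instance Definition _ :=
  isSigmaFinite.Build _ _ _ leb_step leb_step_sigma_finite.

End step.

Fixpoint leb n : {sigma_finite_measure set 'rV[R]_n -> \bar R} :=
  match n with
  | 0 => dirac (0 : 'rV[R]_0)
  | n'.+1 => leb_step (leb n')
  end.

Lemma leb_box n (a b : 'rV[R]_n) : (forall i, a ord0 i <= b ord0 i) ->
  leb n [set x | forall i, x ord0 i \in `[a ord0 i, b ord0 i]] =
  (\prod_(i < n) (b ord0 i - a ord0 i))%:E.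
Proof.
elim: n a b => [|n IHn] a b ab.
  by rewrite big_ord0 /= diracE mem_set// => -[].
pose tl (x : 'rV[R]_n.+1) : 'rV[R]_n := \row_j x ord0 (lift ord0 j).
pose box : set 'rV[R]_n := [set x | forall i, x ord0 i \in `[tl a ord0 i, tl b ord0 i]].
rewrite [LHS](_ : _ = (lebesgue_measure \x leb n)%E
    (`[a ord0 ord0, b ord0 ord0]%classic `*` box)); last first.
  congr (product_measure1 _ _ _).
  apply/seteqP; split => [p /= xab|p /= [p1 p2] i].
    split; first by have := xab ord0; rewrite rV_cons0.
    by move=> i; have := xab (lift ord0 i); rewrite rV_consS !mxE.
  case: (unliftP ord0 i) => [j|] ->; last by rewrite rV_cons0.
  by have := p2 j; rewrite rV_consS !mxE.
rewrite product_measure1E//; last first.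
  rewrite (_ : box = \bigcap_(i : 'I_n)
      ((fun x : 'rV[R]_n => x ord0 i : measurableTypeR R) @^-1`
        `[tl a ord0 i, tl b ord0 i]%classic)); last first.
    by apply/seteqP; split => [x xab i _|x xab i]; [exact: xab|exact: xab].
  apply: fin_bigcap_measurable => // i _.
  by rewrite -[X in measurable X]setTI; exact: measurable_coord.
rewrite IHn/box; last by move=> i; rewrite !mxE.
rewrite [in RHS]big_ord_recl EFinM; congr (_ * _)%E.
  transitivity (@lebesgue_measure R `[a ord0 ord0, b ord0 ord0]%classic) => //.
  rewrite lebesgue_measure_itv/= lte_fin -EFinB.
  by case: ltgtP (ab ord0) => // -> _; rewrite subrr.
by congr (_%:E); apply: eq_bigr => i _; rewrite !mxE.
Qed.

End lebesgue_rV.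

Section complex_space.
Context {R : realType}.
Local Notation C := R[i].

Definition enorm n (x : 'rV[R]_n) : R := Num.sqrt (\sum_i x ord0 i ^+ 2).

Definition japanese n (x : 'rV[R]_n) : R := Num.sqrt (1 + enorm x ^+ 2).

(* the Euclidean norm of C^m *)
Definition cnorm m (z : 'I_m -> C) : R :=
  Num.sqrt (\sum_j Normc.normc (z j) ^+ 2).

Definition cdot (a b : C) : R := complex.Re (a * conjc b).

Variable N : nat.
Local Notation X := 'rV[R]_N.

(* [leb N] is carried by the Borel sigma-algebra, so f is Lebesgue
   measurable iff it coincides a.e. with a (Borel) measurable function. *)
Definition ae_measurable (f : X -> R) : Prop :=
  exists2 f0, measurable_fun [set: X] f0 &
    {ae leb N, forall x, f x = f0 x}.

Definition ae_integrable (f : X -> R) : Prop :=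
  exists2 f0, (leb N).-integrable [set: X] (EFin \o f0) &
    {ae leb N, forall x, f x = f0 x}.

Definition ae_Lp (p : \bar R) (f : X -> R) : Prop :=
  exists2 f0, f0 \in Lfun (leb N) p & {ae leb N, forall x, f x = f0 x}.

Definition weakL (q : R) (f : X -> R) : Prop :=
  measurable_fun [set: X] f /\
  exists K : R, forall t : R, 0 < t ->
    (leb N [set x | (t < `|f x|)%R] <= (K * t `^ (- q))%:E)%E.

Definition pderiv (k : 'I_N) (f : X -> R) : X -> R :=
  fun x => 'D_(delta_mx ord0 k) f x.

(* The multi-index alpha is encoded by the list of the |alpha| directions of
   differentiation. *)
Definition ipderiv (l : seq 'I_N) (f : X -> R) : X -> R := foldr pderiv f l.

Definition smooth (f : X -> R) : Prop :=
  forall l, continuous (ipderiv l f) /\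
    forall k x, derivable (ipderiv l f) x (delta_mx ord0 k).

Definition Ccinfty (u : X -> C) : Prop :=
  [/\ smooth (@complex.Re R \o u), smooth (@complex.Im R \o u) &
      compact (closure [set x | u x != 0])].

Definition L2norm (u : X -> C) : \bar R :=
  Lnorm (leb N) 2%:E (fun x => (Normc.normc (u x))%:E).

Definition L2 (u : X -> C) : Prop :=
  [/\ measurable_fun [set: X] (@complex.Re R \o u),
      measurable_fun [set: X] (@complex.Im R \o u) & (L2norm u < +oo)%E].

Section magnetic.
Variable A : X -> X.

(* (Du)_k = i^{-1} d_k u - A_k u, for a differentiable function u *)
Definition Dsmooth (k : 'I_N) (u : X -> C) : X -> C := fun x =>
  ('i^-1 * (pderiv k (@complex.Re R \o u) x +i* pderiv k (@complex.Im R \o u) x)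
   - (A x ord0 k)%:C * u x)%C.

(* (u, v) is the limit in L^2 of (phi_n, D phi_n) with phi_n in C_c^infty *)
Definition is_magD (u : X -> C) (v : 'I_N -> X -> C) : Prop :=
  [/\ L2 u, forall k, L2 (v k) &
    exists phi : nat -> X -> C,
    [/\ forall n, Ccinfty (phi n),
        L2norm (fun x => phi n x - u x) @[n --> \oo] --> 0%E &
        forall k, L2norm (fun x => Dsmooth k (phi n) x - v k x)
          @[n --> \oo] --> 0%E]].

Definition H1A (u : X -> C) : Prop := exists v, is_magD u v.

(* Du for u in H^1_A; it is determined up to a null set *)
Definition magD (u : X -> C) : 'I_N -> X -> C :=
  xget (fun _ => cst 0) [set v | is_magD u v].

Variable m : nat.
Local Notation F := ('I_m -> X -> C).

Definition HA (Phi : F) : Prop := forall j, H1A (Phi j).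

Definition kinetic (Phi : F) : R :=
  \sum_j \sum_k fine (L2norm (magD (Phi j) k)) ^+ 2.

Definition l2norm (Phi : F) : R :=
  Num.sqrt (\sum_j fine (L2norm (Phi j)) ^+ 2).

Definition hnorm (Phi : F) : R := Num.sqrt (kinetic Phi + l2norm Phi ^+ 2).

Definition rpair (Phi Psi : F) : R :=
  \sum_j \int[leb N]_x cdot (Phi j x) (Psi j x).

(* Elements of the dual of H_A are represented by functions on F, of which only
   the values on H_A matter. *)
Definition in_dual (Lam : F -> R) : Prop :=
  (forall (a : R) Psi Psi', HA Psi -> HA Psi' ->
     Lam (fun j x => a%:C%C * Psi j x + Psi' j x) = a * Lam Psi + Lam Psi') /\
  exists K : R, forall Psi, HA Psi -> `|Lam Psi| <= K * hnorm Psi.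

Definition dnorm (Lam : F -> R) : \bar R :=
  ereal_sup [set `|Lam Psi|%:E | Psi in [set Psi | HA Psi /\ hnorm Psi <= 1]].

(* multiplication by i on the dual: Re (i f, g) = Re (f, - i g) *)
Definition imul (Lam : F -> R) : F -> R :=
  fun Psi => Lam (fun j x => (- 'i * Psi j x)%C).

Definition LA (Phi : F) : F -> R := fun Psi =>
  \sum_j \sum_k \int[leb N]_x cdot (magD (Phi j) k x) (magD (Psi j) k x).

End magnetic.
End complex_space.

Section nonlinearity.
Context {R : realType}.
Variables N m : nat.
Local Notation C := R[i].
Local Notation X := 'rV[R]_N.
Local Notation F := ('I_m -> X -> C).

Definition halfline : set R := [set s | 0 <= s].

(* derivative relative to D (one-sided at the boundary of an interval) *)
Definition has_deriv_on (D : set R) (f : R -> R) (a l : R) : Prop :=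
  (f b - f a) / (b - a) @[b --> within D a^'] --> l.

Definition deriv_on (D : set R) (f : R -> R) (a : R) : R :=
  lim ((f b - f a) / (b - a) @[b --> within D a^']).

Definition upd (s : 'I_m -> R) (j : 'I_m) (y : R) : 'I_m -> R :=
  fun i => if i == j then y else s i.

Variables (V : X -> R) (g : 'I_m -> R -> ('I_m -> R) -> R)
  (W : 'I_m -> 'I_m -> R -> R) (G : R -> ('I_m -> R) -> R) (h : R -> R).

Definition sqmod (z : 'I_m -> C) : 'I_m -> R :=
  fun i => Normc.normc (z i) ^+ 2.

Definition fnl (j : 'I_m) (x : X) (z : 'I_m -> C) : C :=
  (g j (enorm x) (sqmod z))%:C%C * z j.

Definition hconv (w : R -> R) (u : X -> C) (x : X) : R :=
  \int[leb N]_y (w (enorm (x - y)) * h (Normc.normc (u y))).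

(* h'(|z|) z / |z|, with value 0 at z = 0 *)
Definition hdir (z : C) : C :=
  if z == 0 then 0
  else (deriv_on halfline h (Normc.normc z) / Normc.normc z)%:C%C * z.

Definition gtilde1 (Phi : F) : F := fun j x => (V x)%:C%C * Phi j x.

Definition gtilde2 (Phi : F) : F := fun j x => fnl j x (fun i => Phi i x).

Definition gtilde3 (Phi : F) : F := fun j x =>
  \sum_i (hconv (W i j) (Phi i) x)%:C%C * hdir (Phi j x).

Definition gtilde (Phi : F) : F := fun j x =>
  - gtilde1 Phi j x + gtilde2 Phi j x + gtilde3 Phi j x.

Definition energy (A : X -> X) (Phi : F) : R :=
  2^-1 * kinetic A Phi
  + 2^-1 * (\int[leb N]_x (V x * \sum_j Normc.normc (Phi j x) ^+ 2))
  - \int[leb N]_x G (enorm x) (sqmod (fun j => Phi j x))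
  - 2^-1 * (\sum_i \sum_j fine (\int[leb N]_x \int[leb N]_y
      (W i j (enorm (x - y)) * h (Normc.normc (Phi i x))
       * h (Normc.normc (Phi j y)))%:E)%E).

Definition timeI (Tm Tp : \bar R) : set R :=
  [set t | (- Tm < t%:E)%E /\ (t%:E < Tp)%E].

(* Phi is in C(I, H_A) and in C^1(I, H_A'), I = (-Tm, Tp), and solves
   i Phi' - L_A Phi + gtilde(Phi) = 0 in H_A', Phi(0) = Phi0. *)
Record solution (A : X -> X) (Phi0 : F) (Tm Tp : \bar R) (Phi : R -> F) :
    Prop := {
  sol_mem : forall t, timeI Tm Tp t -> HA A (Phi t) ;
  sol_cont : forall t, timeI Tm Tp t ->
    hnorm A (fun j x => Phi s j x - Phi t j x) @[s --> t] --> 0 ;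
  (* makes the pairing of gtilde(Phi) with H_A in the equation meaningful *)
  sol_gtilde : forall t, timeI Tm Tp t -> forall Psi, HA A Psi -> forall j,
    ae_integrable (fun x => cdot (gtilde (Phi t) j x) (Psi j x)) ;
  sol_eq : exists dPhi : R -> F -> R, forall t, timeI Tm Tp t ->
    [/\ in_dual A (dPhi t),
        dnorm A (fun Psi => tau^-1 *
            (rpair (Phi (t + tau)) Psi - rpair (Phi t) Psi) - dPhi t Psi)
          @[tau --> 0^'] --> 0%E,
        dnorm A (fun Psi => dPhi s Psi - dPhi t Psi) @[s --> t] --> 0%E &
        forall Psi, HA A Psi ->
          imul (dPhi t) Psi - LA A (Phi t) Psi + rpair (gtilde (Phi t)) Psi = 0] ;
  sol_init : forall j, {ae leb N, forall x, Phi 0 j x = Phi0 j x} }.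

(* The maximal solution, with the properties which come with it: blow-up
   alternative and conservation of charge and energy. *)
Record maximal_solution (A : X -> X) (Phi0 : F) (Tm Tp : \bar R)
    (Phi : R -> F) : Prop := {
  max_Tm : (0 < Tm)%E ;
  max_Tp : (0 < Tp)%E ;
  max_sol : solution A Phi0 Tm Tp Phi ;
  max_blowup_p : (Tp < +oo)%E ->
    hnorm A (Phi t) @[t --> (fine Tp)^'-] --> +oo ;
  max_blowup_m : (Tm < +oo)%E ->
    hnorm A (Phi t) @[t --> (- fine Tm)^'+] --> +oo ;
  max_charge : forall t, timeI Tm Tp t -> l2norm (Phi t) = l2norm Phi0 ;
  max_energy : forall t, timeI Tm Tp t -> energy A (Phi t) = energy A Phi0 }.

Definition assA (A : X -> X) : Prop :=
  (forall k, smooth (fun x => A x ord0 k)) /\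
  forall l : seq 'I_N, (0 < size l)%N ->
    exists K : R, forall x,
      enorm (\row_k ipderiv l (fun x => A x ord0 k) x) <= K.

Definition Bfield (A : X -> X) (j k : 'I_N) : X -> R := fun x =>
  pderiv j (fun x => A x ord0 k) x - pderiv k (fun x => A x ord0 j) x.

Definition assB (A : X -> X) : Prop :=
  exists2 eps : R, 0 < eps & forall l : seq 'I_N, (0 < size l)%N ->
    exists K : R, forall x j k,
      `|ipderiv l (Bfield A j k) x| <= K * japanese x `^ (- 1 - eps).

Definition assV : Prop :=
  exists p : R, [/\ 1 <= p, N%:R / 2 <= p &
    ae_Lp p%:E V \/
    exists V1 V2, [/\ ae_Lp p%:E V1, ae_Lp +oo%E V2 &
      {ae leb N, forall x, V x = V1 x + V2 x}]].

Definition assW (q : R) : Prop :=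
  Num.max 1 (N%:R / 4) < q /\ forall i j,
    [/\ forall r : R, 0 <= r -> 0 <= W i j r,
        (* W may be singular at 0, where its value plays no role *)
        forall r s : R, 0 < r -> r <= s -> W i j s <= W i j r,
        forall r, W i j (- r) = W i j r,
        weakL q (fun x : X => W i j (enorm x)) &
        forall r, W i j r = W j i r].

Definition assg : Prop :=
  exists K alpha : R, [/\ 0 < K, 0 <= alpha,
    (2 < N)%N -> alpha < 4 / (N%:R - 2) &
    forall j,
    [/\ forall z : 'I_m -> C, ae_measurable (fun x => complex.Re (fnl j x z)) /\
                  ae_measurable (fun x => complex.Im (fnl j x z)),
        {ae leb N, forall x, forall (z : 'I_m -> C) (e : R), 0 < e ->
           exists2 d : R, 0 < d & forall z' : 'I_m -> C,
             cnorm (fun i => z' i - z i) < d ->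
             Normc.normc (fnl j x z' - fnl j x z) < e} &
        {ae leb N, forall x, forall z z',
           Normc.normc (fnl j x z' - fnl j x z) <=
           K * (cnorm z `^ alpha + cnorm z' `^ alpha)
             * cnorm (fun i => z' i - z i)}]].

Definition potentialG : Prop :=
  (exists Z : set (measurableTypeR R),
    [/\ measurable Z, lebesgue_measure Z = 0 &
        forall s : 'I_m -> R, (forall i, 0 <= s i) ->
          measurable_fun (`]0, +oo[%classic `\` Z : set (measurableTypeR R))
            (fun r : measurableTypeR R => G r s)]) /\
  forall (r : R) (s : 'I_m -> R) j, 0 < r -> (forall i, 0 <= s i) ->
    {within halfline, continuous (fun y => G r (upd s j y))} /\
    has_deriv_on halfline (fun y => G r (upd s j y)) (s j) (2^-1 * g j r s).

Definition assG (l : 'I_m -> R) : Prop :=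
  exists2 K : R, 0 < K & forall (r : R) (s : 'I_m -> R), 0 < r -> (forall i, 0 <= s i) ->
    0 <= G r s /\
    G r s <= K * (\sum_j s j + \sum_j s j `^ ((l j + 2) / 2)).

Definition assh (q mu : R) : Prop :=
  let h1 := deriv_on halfline h in
  [/\ forall s : R, 0 <= s -> 0 <= h s,
      forall s : R, 0 <= s -> has_deriv_on halfline h s (h1 s),
      {within halfline, continuous h1},
      forall r s : R, 0 <= r -> r <= s -> h r <= h s & h 0 = 0] /\
  [/\ forall s : R, 0 < s -> derivable h1 s 1,
      exists K D E : R, [/\ 0 < K, 0 < D, 0 < E,
        forall s : R, 0 <= s -> h s <= K * s `^ mu /\
                            `|h1 s| <= D * s `^ (mu - 1) &
        forall s : R, 0 < s -> `|derive1 h1 s| <= E * s `^ (mu - 2)],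
      2 <= mu & mu <= (6 * q - 1) / (2 * q) - (N%:R - 2) / N%:R].

End nonlinearity.

(* Main.v *)
Require Import Defs.
From HB Require Import structures.
From mathcomp Require Import all_boot all_order all_algebra.
From mathcomp Require Import complex.
From mathcomp Require Import ring lra.
From mathcomp Require Import all_classical all_reals all_analysis.
From mathcomp Require Import measurable_realfun.

Set Implicit Arguments.
Unset Strict Implicit.
Unset Printing Implicit Defensive.

Import Order.TTheory GRing.Theory Num.Theory.
Import numFieldNormedType.Exports.

Local Open Scope classical_set_scope.
Local Open Scope ring_scope.

(** Charge and energy are conserved and V > 0, so the kinetic energy K satisfies
    K <= 2 E + 2 (int G) + (Hartree terms), and it is enough to bound the
    right-hand side by a constant plus a sublinear power of K.

    Instead of a Gagliardo-Nirenberg inequality we use its weak-type endpoint: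
    the measure of {|u| > t} is at most C (1 + K) t^-(2 + 4/N), where C depends
    on the mass only.  By the diamagnetic inequality on lines, |u| satisfies
    || |u|(. + z) - |u| ||_2 <= C |z| K^(1/2); at a point where |u| > 2 t, half
    of the points of a cube of volume 2 ||u||_2^2 / t^2 have |u| <= t, and
    averaging over the cube gives the estimate.  A dyadic decomposition turns it
    into int |u|^p <= C (1 + K)^(N (p - 2) / 4) for 2 <= p < 2 + 4/N, the
    exponent being less than 1.

    For the Hartree terms, W is at most 1 plus its restriction to {W > 1}, which
    lies in L^p for every p < q; Young's convolution inequality with p close
    to q yields the powers N (mu - 2) / 2 and N (mu - 2 + 1/p) / 2 of 1 + K,
    which are less than 1 by the strict upper bound on mu. *)

(** * Borel measurability and translations in R^n *)

(** The obstacle is that |u| has no directly usable derivative: an element of H^1_A is only an L^2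
    limit of test functions, and the modulus is not smooth at zeros. Regularity is therefore
    expressed by increments of |u|, estimated for test functions only; the estimate passes to the
    limit at the level of superlevel sets, where Chebyshev's inequality is enough. The exponent 2 +
    4/N is the mass-critical one: there the level-set bound is linear in K, so interpolation with
    the conserved mass gives, strictly below it, a power of K less than 1. Each nonlinear term is
    finally bounded by e K + C, with e small enough for half of K to be absorbed on the left. The
    constants depend on the data, the mass and the energy, but not on time; the blow-up alternative
    then turns the bound into global existence. *)

Section translation.
Context {R : realType}.

Lemma lebesgue_measure_shift (c : R) (A : set (measurableTypeR R)) :
  measurable A ->
  pushforward lebesgue_measure ((fun t => t + c) : _ -> measurableTypeR R) A
  = lebesgue_measure A.
Proof.
move=> mA; apply/esym.
have mc : measurable_fun [set: measurableTypeR R]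
    ((fun t => t + c) : _ -> measurableTypeR R).
  by apply: measurable_funD => //; exact: measurable_cst.
pose mu : {measure set (measurableTypeR R) -> \bar R} :=
  measure_function_pushforward__canonical__measure_function_Measure
    lebesgue_measure mc.
apply: (lebesgue_measure_unique (mu := mu)) => // _ [[a b]] _ <- /=.
rewrite /pushforward.
have -> : (fun t => t + c) @^-1` `]a, b] = `]a - c, b - c]%classic.
  by apply/seteqP; split=> t /=; rewrite !in_itv/= ltrBlDr lerBrDr.
rewrite !lebesgue_measure_itv/= !lte_fin ltrD2r -!EFinB.
by case: ifP => // _; congr (_%:E); ring.
Qed.

Lemma integral_shiftR (c : R) (f : measurableTypeR R -> \bar R) :
  measurable_fun setT f -> (forall x, 0 <= f x)%E ->
  (\int[lebesgue_measure]_t f (t + c)%R = \int[lebesgue_measure]_t f t)%E.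
Proof.
move=> mf f0.
have mc : measurable_fun [set: measurableTypeR R]
    ((fun t => t + c) : _ -> measurableTypeR R).
  by apply: measurable_funD => //; exact: measurable_cst.
rewrite -[LHS](@ge0_integral_pushforward _ _ _ _ _ _ mc lebesgue_measure setT f)//.
by apply: eq_measure_integral => A mA _; exact: lebesgue_measure_shift.
Qed.

(** [leb n.+1] is by construction a pushforward of a product, so this is a change of variables
    followed by Tonelli; it is what allows induction on the dimension. *)
Lemma integral_lebS n (f : 'rV[R]_n.+1 -> \bar R) :
  measurable_fun setT f -> (forall x, 0 <= f x)%E ->
  (\int[leb n.+1]_x f x =
   \int[lebesgue_measure]_t \int[leb n]_y f (rV_cons (t, y)))%E.
Proof.
move=> mf f0.
transitivity (\int[(lebesgue_measure \x leb n)%E]_p f (rV_cons p))%E.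
  rewrite -[RHS](@ge0_integral_pushforward _ _ _ _ _ _ (@measurable_rV_cons R n)
    (lebesgue_measure \x leb n)%E setT f)//.
rewrite fubini_tonelli1//.
by apply: measurableT_comp => //; exact: measurable_rV_cons.
Qed.

Lemma measurable_rV_shift n (z : 'rV[R]_n) :
  measurable_fun setT (fun x : 'rV[R]_n => x + z).
Proof.
apply: measurable_fun_rV => i; under eq_fun do rewrite mxE.
apply: measurable_funD; last exact: measurable_cst.
exact: measurable_coord.
Qed.

(** Induction on the dimension: by [integral_lebS] a translation splits into a shift of the first
    coordinate and a translation of the tail by [z']. *)
Lemma integral_shift n (z : 'rV[R]_n) (f : 'rV[R]_n -> \bar R) :
  measurable_fun setT f -> (forall x, 0 <= f x)%E ->
  (\int[leb n]_x f (x + z)%R = \int[leb n]_x f x)%E.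
Proof.
elim: n z f => [|n IH] z f mf f0.
  by apply: eq_integral => x _; congr f; apply/rowP => -[].
have mfz : measurable_fun setT (fun x : 'rV[R]_n.+1 => f (x + z)).
  by apply: measurableT_comp => //; exact: measurable_rV_shift.
have fz0 x : (0 <= f (x + z)%R)%E by exact: f0.
rewrite (integral_lebS mf f0) (integral_lebS mfz fz0).
pose z' : 'rV[R]_n := \row_j z ord0 (lift ord0 j).
have consD t y : rV_cons (t, y) + z = rV_cons (t + z ord0 ord0, y + z').
  apply/rowP => i; rewrite mxE; case: (unliftP ord0 i) => [j|] ->.
    by rewrite !rV_consS /= !mxE.
  by rewrite !rV_cons0.
transitivity (\int[lebesgue_measure]_t \int[leb n]_y
    f (rV_cons ((t + z ord0 ord0)%R, y)))%E.
  apply: eq_integral => t _; under eq_integral do rewrite consD.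
  apply: (IH z' (fun y => f (rV_cons (t + z ord0 ord0, y)))) => //.
  apply: measurableT_comp => //.
  apply: (@measurableT_comp _ _ _ _ _ _ (@rV_cons R n)).
    exact: measurable_rV_cons.
  exact: pair1_measurable.
apply: (@integral_shiftR (z ord0 ord0) (fun t => \int[leb n]_y f (rV_cons (t, y)))%E).
  apply: (measurable_fun_fubini_tonelli_F (fun p => f (rV_cons p))) => //.
  by apply: measurableT_comp => //; exact: measurable_rV_cons.
by move=> t; exact: integral_ge0.
Qed.

End translation.

(** * Continuous functions on row vectors are measurable *)

Section continuous_measurable.
Context {R : realType} (n : nat).

(** The sigma-algebra on row vectors is generated by the coordinates, not by the open sets, so
    continuity does not give measurability at once. Rounding to the lattice of mesh 1/(k+1) makes a
    continuous function a pointwise limit of functions with countably many values. *)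
Definition grid (k : nat) (x : 'rV[R]_n) : 'rV[int]_n :=
  \row_i Num.floor (k.+1%:R * x ord0 i).

Definition of_grid (k : nat) (z : 'rV[int]_n) : 'rV[R]_n :=
  \row_i ((z ord0 i)%:~R / k.+1%:R).

Lemma cvg_grid (x : 'rV[R]_n) : of_grid k (grid k x) @[k --> \oo] --> x.
Proof.
apply/cvgrPdist_le => e e0.
have := near_infty_natSinv_lt (PosNum e0); apply: filterS => k /= ke.
rewrite [leLHS]mx_normrE; apply/bigmax_leP; split; first exact: ltW.
move=> [i j] _ /=; rewrite !mxE (ord1 i).
set y := x ord0 j.
have k0 : (0 : R) < k.+1%:R by rewrite ltr0n.
have : y - (Num.floor (k.+1%:R * y))%:~R / k.+1%:R =
  (k.+1%:R * y - (Num.floor (k.+1%:R * y))%:~R) / k.+1%:R.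
  by field; lra.
move=> ->.
have := floor_itv (k.+1%:R * y) => /andP[h1 h2].
rewrite ger0_norm; last by rewrite divr_ge0 ?subr_ge0// ltW.
apply: le_trans (ltW ke); rewrite -[leRHS]div1r ler_wpM2r ?invr_ge0 ?ltW//.
by rewrite ltrBlDl; move: h2; rewrite intrD.
Qed.

Lemma continuous_measurable_rV (f : 'rV[R]_n -> R) :
  continuous f -> measurable_fun setT f.
Proof.
move=> cf.
apply: (@measurable_fun_cvg _ _ _ _ (fun k x => f (of_grid k (grid k x)))); last first.
  by move=> x _; apply: (cvg_comp _ _ (@cvg_grid x)); exact: cf.
move=> k _ Y mY; rewrite setTI.
(* The rounded function is constant on each lattice cell, so its preimages are countable unions of
   cells, and a cell is a product of half-open intervals. *)
rewrite (_ : _ @^-1` Y = \bigcup_(z in [set z | Y (f (of_grid k z))])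
   [set x | grid k x = z]); last first.
  apply/seteqP; split=> [x Yx|x [z /= Yz gz]]; first by exists (grid k x).
  by rewrite gz.
rewrite bigcup_mkcond; apply: countable_bigcupT_measurable => [|z].
  exact: countableP.
case: ifP => // _.
rewrite (_ : [set x | _] = \bigcap_(i : 'I_n)
    ((fun x : 'rV[R]_n => x ord0 i : measurableTypeR R) @^-1`
      [set t | Num.floor (k.+1%:R * t) = z ord0 i])).
  apply: fin_bigcap_measurable => // i _.
  rewrite -[X in measurable X]setTI; apply: measurable_coord => //.
  have k0 : (0 : R) < k.+1%:R by rewrite ltr0n.
  rewrite (_ : [set t | _] = `[(z ord0 i)%:~R / k.+1%:R, (z ord0 i + 1)%:~R / k.+1%:R[%classic).
    exact: measurable_itv.
  apply/seteqP; split=> t /=; rewrite in_itv/= ler_pdivrMr// ltr_pdivlMr// mulrC.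
    by move=> <-; exact: floor_itv.
  by move=> /floor_def.
apply/seteqP; split=> x /=.
  by move=> <- i _ /=; rewrite mxE.
by move=> h; apply/rowP => i; rewrite mxE; exact: h.
Qed.

End continuous_measurable.

(** * The diamagnetic inequality *)

Section diamagnetic1.
Context {R : realType}.
Local Notation mu := (@lebesgue_measure R).

(** Cauchy-Schwarz recovered from its weighted linear forms. The weight c = s / (2 |d|) is expressed
    through d rather than by minimising over c, so that J = 0 needs no separate case. *)
Lemma sqr_le_of_weighted (d s J : R) : 0 < s -> 0 <= J ->
  (forall c, 0 < c -> `|d| <= c * J + s / (4 * c)) -> d ^+ 2 <= s * J.
Proof.
move=> s0 J0 h; rewrite -real_normK ?num_real//.
have [->|d0] := eqVneq d 0; first by rewrite normr0 expr0n mulr_ge0// ltW.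
have {}d0 : 0 < `|d| by rewrite normr_gt0.
have := h (s / (2 * `|d|)) ltac:(rewrite divr_gt0// mulr_gt0//).
have -> : s / (2 * `|d|) * J + s / (4 * (s / (2 * `|d|))) =
    (s * J + `|d| ^+ 2) / (2 * `|d|).
  by field; rewrite ?gt_eqF.
rewrite ler_pdivlMr ?mulr_gt0//; nra.
Qed.

(** Pointwise |f| <= c f^2 + 1/(4c) for every c > 0; integrated over [0, s], this is the hypothesis
    of [sqr_le_of_weighted]. The majorant [g] of f^2 is where the diamagnetic inequality will be
    inserted. *)
Lemma sqr_increment_le (F f g : R -> R) (s : R) : 0 < s ->
  (forall t : R, is_derive t 1 F (f t)) -> continuous f -> continuous g ->
  (forall t, f t ^+ 2 <= g t) ->
  (F s - F 0) ^+ 2 <= s * (\int[mu]_(t in `[0, s]) g t).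
Proof.
move=> s0 dF cf cg fg.
have int (k : R -> R) : continuous k -> mu.-integrable `[0, s] (EFin \o k).
  move=> ck; apply: continuous_compact_integrable; first exact: segment_compact.
  exact: continuous_subspaceT.
have FTC : \int[mu]_(t in `[0, s]) f t = F s - F 0.
  have := @continuous_FTC2 R f F 0 s s0 (continuous_subspaceT cf).
  rewrite /Rintegral => -> //.
    have cF t : {for t, continuous F}.
      apply: differentiable_continuous; apply/derivable1_diffP.
      by have [] := dF t.
    split; first by move=> t _; have [] := dF t.
      by apply: cvg_at_right_filter; exact: cF.
    by apply: cvg_at_left_filter; exact: cF.
  by move=> t _; rewrite derive1E; have [_ ->] := dF t.
have J0 : 0 <= \int[mu]_(t in `[0, s]) g t.
  by apply: Rintegral_ge0 => t _; apply: le_trans (fg t); exact: sqr_ge0.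
apply: sqr_le_of_weighted => // c c0.
rewrite -FTC; apply: le_trans (le_normr_Rintegral _ _) _ => //; first exact: int.
have -> : c * (\int[mu]_(t in `[0, s]) g t) + s / (4 * c) =
    \int[mu]_(t in `[0, s]) (c * g t + (4 * c)^-1).
  rewrite RintegralD//; last 2 first.
  - by apply: (int (fun t => c * g t)) => t; apply: cvgM; [exact: cvg_cst|exact: cg].
  - by apply: (int (fun t => (4 * c)^-1)) => t; exact: cvg_cst.
  rewrite RintegralZl//; last exact: int.
  rewrite Rintegral_cst//= lebesgue_measure_itv/= lte_fin s0 oppr0 adde0/=.
  by congr +%R; field; rewrite gt_eqF//.
apply: le_Rintegral => //.
- apply: (int (fun t => `|f t|)) => t.
  by apply: cvg_norm; exact: cf.
- apply: (int (fun t => c * g t + (4 * c)^-1)) => t.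
  by apply: cvgD; [apply: cvgM; [exact: cvg_cst|exact: cg]|exact: cvg_cst].
move=> t _.
have := fg t; rewrite -real_normK ?num_real// => fgt.
have : c * `|f t| ^+ 2 + (4 * c)^-1 - `|f t| = (c * `|f t| - 2^-1) ^+ 2 / c.
  by field; rewrite gt_eqF.
have : 0 <= (c * `|f t| - 2^-1) ^+ 2 / c by rewrite divr_ge0 ?sqr_ge0 ?ltW.
have : c * `|f t| ^+ 2 <= c * g t by rewrite ler_pM2l.
lra.
Qed.

(* The gauge field [al] drops out of [a * da + b * db]. *)
Lemma diamagnetic_line (a b da db al : R -> R) (s : R) : 0 < s ->
  (forall t : R, is_derive t 1 a (da t)) -> (forall t : R, is_derive t 1 b (db t)) ->
  continuous da -> continuous db -> continuous al ->
  (Num.sqrt (a s ^+ 2 + b s ^+ 2) - Num.sqrt (a 0 ^+ 2 + b 0 ^+ 2)) ^+ 2 <=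
  s * (\int[mu]_(t in `[0, s])
        ((da t + al t * b t) ^+ 2 + (db t - al t * a t) ^+ 2)).
Proof.
move=> s0 da_ db_ cda cdb cal.
have ca : continuous a.
  by move=> t; apply/differentiable_continuous/derivable1_diffP; have [] := da_ t.
have cb : continuous b.
  by move=> t; apply/differentiable_continuous/derivable1_diffP; have [] := db_ t.
pose q t := a t ^+ 2 + b t ^+ 2.
pose g t := (da t + al t * b t) ^+ 2 + (db t - al t * a t) ^+ 2.
set J := \int[mu]_(t in `[0, s]) _.
have cg : continuous g.
  move=> t; apply: cvgD; apply: (@cvg_comp _ _ _ _ (fun x : R => x ^+ 2))
    (@exprn_continuous _ 2 _).
    by apply: cvgD; [exact: cda|apply: cvgM; [exact: cal|exact: cb]].
  by apply: cvgB; [exact: cdb|apply: cvgM; [exact: cal|exact: ca]].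
have J0 : 0 <= J by apply: Rintegral_ge0 => t _; rewrite addr_ge0 ?sqr_ge0.
have q0 t : 0 <= q t by rewrite addr_ge0 ?sqr_ge0.
(* The modulus is not differentiable where a = b = 0, hence the regularisation sqrt(q + e^2), whose
   bound is uniform in e. *)
have step e : 0 < e ->
    (Num.sqrt (q s + e ^+ 2) - Num.sqrt (q 0 + e ^+ 2)) ^+ 2 <= s * J.
  move=> e0.
  have qe t : 0 < q t + e ^+ 2 by rewrite ltr_wpDl ?exprn_gt0.
  have cq : continuous (fun t => q t + e ^+ 2).
    move=> t; apply: cvgD; last exact: cvg_cst.
    by apply: cvgD; apply: (@cvg_comp _ _ _ _ (fun x : R => x ^+ 2)) (@exprn_continuous _ 2 _);
      [exact: ca|exact: cb].
  pose F t := Num.sqrt (q t + e ^+ 2).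
  pose f t := (a t * da t + b t * db t) / F t.
  have F0 t : 0 < F t by rewrite sqrtr_gt0.
  apply: (@sqr_increment_le F f g) => //.
  - move=> t.
    have dq : is_derive t 1 (fun t => q t + e ^+ 2) (2 * (a t * da t + b t * db t)).
      have := da_ t; have := db_ t => h1 h2; rewrite /q.
      apply: is_derive_eq; rewrite /GRing.scale/= !addr0; ring.
    have := is_derive1_sqrt (qe t) => ds.
    have := @is_derive1_comp R Num.sqrt (fun t => q t + e ^+ 2) t _ _ ds dq.
    have -> // : f t = (2 * Num.sqrt (q t + e ^+ 2))^-1 * (2 * (a t * da t + b t * db t)).
    by rewrite /f -/(F t); field; exact: lt0r_neq0.
  - move=> t; apply: cvgM.
      by apply: cvgD; apply: cvgM; [exact: ca|exact: cda|exact: cb|exact: cdb].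
    apply: cvgV; first exact: lt0r_neq0.
    exact: (continuous_comp (cq t) (@sqrt_continuous _ _)).
  - move=> t; rewrite /f expr_div_n ler_pdivrMr ?exprn_gt0//.
    rewrite /F sqr_sqrtr ?(ltW (qe t))// /g /q.
    (* Lagrange's identity: with X = da + al b and Y = db - al a one has a X + b Y = a da + b db,
       and (a^2 + b^2)(X^2 + Y^2) exceeds its square by (a Y - b X)^2. *)
    have /= := sqr_ge0 (a t * (db t - al t * a t) - b t * (da t + al t * b t)).
    have : 0 <= ((da t + al t * b t) ^+ 2 + (db t - al t * a t) ^+ 2) * e ^+ 2.
      by rewrite mulr_ge0 ?addr_ge0 ?sqr_ge0.
    lra.
rewrite -/(q s) -/(q 0) -real_normK ?num_real//.
have sJ : 0 <= s * J by rewrite mulr_ge0// ltW.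
rewrite -(sqr_sqrtr sJ) ler_pXn2r ?nnegrE ?sqrtr_ge0//.
(* The limit e -> 0 uses sqrt q <= sqrt(q + e^2) <= sqrt q + e at both endpoints, which costs at
   most e in the increment. *)
apply/ler_addgt0Pr => e e0.
have {}step := step _ e0.
have le t : Num.sqrt (q t) <= Num.sqrt (q t + e ^+ 2).
  by rewrite ler_wsqrtr// lerDl sqr_ge0.
have ge t : Num.sqrt (q t + e ^+ 2) <= Num.sqrt (q t) + e.
  have h : 0 <= Num.sqrt (q t) + e by rewrite addr_ge0 ?sqrtr_ge0 ?ltW.
  rewrite -[leRHS]ger0_norm// -sqrtr_sqr ler_wsqrtr// sqrrD sqr_sqrtr//.
  by rewrite lerD2r lerDl mulrn_wge0// mulr_ge0 ?sqrtr_ge0 ?ltW.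
move: step; rewrite -{1}(sqr_sqrtr sJ) -real_normK ?num_real// ler_pXn2r ?nnegrE ?sqrtr_ge0//.
have := le s; have := le 0; have := ge s; have := ge 0.
rewrite !ler_norml => ? ? ? ? /andP[? ?]; apply/andP; split; lra.
Qed.
End diamagnetic1.

Section line_integral.
Context {R : realType} (n : nat).
Local Notation X := 'rV[R]_n.
Local Notation mu := (@lebesgue_measure R).

Lemma measurable_line (k : 'I_n) :
  measurable_fun setT (fun p : X * measurableTypeR R => p.1 + p.2 *: delta_mx ord0 k).
Proof.
apply: measurable_fun_rV => i; under eq_fun do rewrite !mxE.
apply: measurable_funD.
  by apply: (measurableT_comp (measurable_coord i)); exact: measurable_fst.
by apply: measurable_funM => //; exact: measurable_snd.
Qed.

Variables (k : 'I_n) (s : R) (g : X -> \bar R).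
Hypotheses (s0 : 0 < s) (mg : measurable_fun setT g) (g0 : forall x, (0 <= g x)%E).
Let e : X := delta_mx ord0 k.
Let ind (t : measurableTypeR R) : \bar R := (\1_(`[0, s]%classic : set R) t)%:E.
Let H (p : X * measurableTypeR R) : \bar R := (g (p.1 + p.2 *: e)%R * ind p.2)%E.

Let ind0 t : (0 <= ind t)%E. Proof. by rewrite lee_fin. Qed.

Let mind : measurable_fun setT ind.
Proof.
by apply/measurable_EFinP; apply: measurable_indic; exact: measurable_itv.
Qed.

Let H0 p : (0 <= H p)%E. Proof. by rewrite mule_ge0. Qed.

Let mH : measurable_fun setT H.
Proof.
apply: emeasurable_funM.
  by apply: measurableT_comp => //; exact: measurable_line.
exact: (measurableT_comp mind (@measurable_snd _ _ X (measurableTypeR R))).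
Qed.

Let HE x : (\int[mu]_(t in `[0%R, s]) g (x + t *: e)%R = \int[mu]_t H (x, t))%E.
Proof.
rewrite integral_mkcond; apply: eq_integral => t _.
rewrite /H /ind patchE /= indicE; case: ifP => _; first by rewrite mule1.
by rewrite mule0.
Qed.

Lemma measurable_integral_line :
  measurable_fun setT (fun x : X => \int[mu]_(t in `[0%R, s]) g (x + t *: e)%R)%E.
Proof.
under eq_fun do rewrite HE.
exact: (measurable_fun_fubini_tonelli_F H mH H0).
Qed.

(** After Tonelli, translation invariance makes the inner integral over x the same for every t in
    [0, s]. *)
Lemma integral_line :
  (\int[leb n]_x \int[mu]_(t in `[0%R, s]) g (x + t *: e)%R =
   s%:E * \int[leb n]_x g x)%E.
Proof.
under eq_integral do rewrite HE.
rewrite (fubini_tonelli H mH H0).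
have E t : (\int[leb n]_x H (x, t) = \int[leb n]_x g x * ind t)%E.
  rewrite /H /= (ge0_integralZr (leb n) measurableT _ (fun x _ => g0 _) (ind0 t)).
    by congr (_ * _)%E; exact: (@integral_shift R n (t *: e) g mg g0).
  by apply: measurableT_comp => //; exact: measurable_rV_shift.
under eq_integral do rewrite E.
have I0 : (0 <= \int[leb n]_x g x)%E by exact: integral_ge0.
rewrite (ge0_integralZl mu measurableT mind (fun t _ => ind0 t) I0).
rewrite muleC; congr (_ * _)%E.
rewrite /ind integral_indic// setIT.
have := @lebesgue_measure_itv R `[0, s]%R; rewrite /= lte_fin s0 oppr0 adde0.
by [].
Qed.

End line_integral.

(** * Mean-square increments of the modulus of a smooth function *)

Section shift_estimate.
Context {R : realType}.
Local Notation mu := (@lebesgue_measure R).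

Lemma continuous_sqr (T : topologicalType) (f : T -> R) :
  continuous f -> continuous (fun x => f x ^+ 2).
Proof.
move=> cf x.
exact: (@continuous_comp _ _ _ f (fun y : R => y ^+ 2) x (cf x) (@exprn_continuous _ 2 _)).
Qed.

Lemma continuous_add (T : topologicalType) (f g : T -> R) :
  continuous f -> continuous g -> continuous (fun x => f x + g x).
Proof. by move=> cf cg x; apply: cvgD; [exact: cf|exact: cg]. Qed.

Lemma continuous_mul (T : topologicalType) (f g : T -> R) :
  continuous f -> continuous g -> continuous (fun x => f x * g x).
Proof. by move=> cf cg x; apply: cvgM; [exact: cf|exact: cg]. Qed.

Lemma continuous_sub (T : topologicalType) (f g : T -> R) :
  continuous f -> continuous g -> continuous (fun x => f x - g x).
Proof. by move=> cf cg x; apply: cvgB; [exact: cf|exact: cg]. Qed.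

Lemma normcE2 (z : R[i]) :
  Normc.normc z = Num.sqrt (complex.Re z ^+ 2 + complex.Im z ^+ 2).
Proof. by case: z. Qed.

Lemma normc_ge0 (z : R[i]) : 0 <= Normc.normc z.
Proof. by rewrite normcE2 sqrtr_ge0. Qed.

Lemma sqr_normcE (z : R[i]) :
  Normc.normc z ^+ 2 = complex.Re z ^+ 2 + complex.Im z ^+ 2.
Proof. by rewrite normcE2 sqr_sqrtr// addr_ge0 ?sqr_ge0. Qed.

Variable n : nat.
Local Notation X := 'rV[R]_n.
Implicit Types (A : X -> X) (u : X -> R[i]) (k : 'I_n).

(** The factor 1/i has modulus 1; what remains is exactly the integrand of [diamagnetic_line], with
    [al] the k-th component of A along the line. *)
Lemma sqr_normc_Dsmooth A k u x :
  Normc.normc (Dsmooth A k u x) ^+ 2 =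
  (pderiv k (@complex.Re R \o u) x + A x ord0 k * complex.Im (u x)) ^+ 2 +
  (pderiv k (@complex.Im R \o u) x - A x ord0 k * complex.Re (u x)) ^+ 2.
Proof.
rewrite sqr_normcE /Dsmooth; case: (u x) => a b /=.
rewrite /Dsmooth /=; set p := pderiv _ _ _; set q := pderiv _ _ _.
set c := A x ord0 k.
by simpc; rewrite /= ; field.
Qed.

Lemma is_derive_line (f : X -> R) k x (t : R) :
  derivable f (x + t *: delta_mx ord0 k) (delta_mx ord0 k) ->
  is_derive t 1 (fun t : R => f (x + t *: delta_mx ord0 k))
    (pderiv k f (x + t *: delta_mx ord0 k)).
Proof.
have E : (fun h : R => h^-1 *: (((fun t : R => f (x + t *: delta_mx ord0 k)) \o
      shift t) (h *: (1 : R)) - f (x + t *: delta_mx ord0 k))) =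
    (fun h : R => h^-1 *: ((f \o shift (x + t *: delta_mx ord0 k))
      (h *: delta_mx ord0 k) - f (x + t *: delta_mx ord0 k))).
  apply/funext => h /=; rewrite [h *: 1]mulr1 scalerDl addrCA.
  by [].
move=> df; apply: DeriveDef; first by rewrite /derivable E.
by rewrite /pderiv /derive E.
Qed.

Variables (A : X -> X) (u : X -> R[i]).
Hypotheses (cA : forall k, continuous (fun x => A x ord0 k))
  (su : smooth (@complex.Re R \o u)) (sv : smooth (@complex.Im R \o u)).

Lemma continuous_Re : continuous (@complex.Re R \o u).
Proof. by have [] := su [::]. Qed.

Lemma continuous_Im : continuous (@complex.Im R \o u).
Proof. by have [] := sv [::]. Qed.

Lemma continuous_sqr_Dsmooth k :
  continuous (fun x => Normc.normc (Dsmooth A k u x) ^+ 2).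
Proof.
under eq_fun do rewrite sqr_normc_Dsmooth.
have cp : continuous (pderiv k (@complex.Re R \o u)) by have [] := su [:: k].
have cq : continuous (pderiv k (@complex.Im R \o u)) by have [] := sv [:: k].
have c1 : continuous (fun x => pderiv k (@complex.Re R \o u) x + A x ord0 k * complex.Im (u x)).
  exact: (continuous_add cp (continuous_mul (@cA k) continuous_Im)).
have c2 : continuous (fun x => pderiv k (@complex.Im R \o u) x - A x ord0 k * complex.Re (u x)).
  exact: (continuous_sub cq (continuous_mul (@cA k) continuous_Re)).
exact: (continuous_add (continuous_sqr c1) (continuous_sqr c2)).
Qed.

Lemma continuous_normc : continuous (fun x => Normc.normc (u x)).
Proof.
under eq_fun do rewrite normcE2.
have c : continuous (fun x => complex.Re (u x) ^+ 2 + complex.Im (u x) ^+ 2).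
  exact: (continuous_add (continuous_sqr continuous_Re) (continuous_sqr continuous_Im)).
by move=> x; exact: (continuous_comp (c x) (@sqrt_continuous _ _)).
Qed.

Lemma continuous_line (x : X) k :
  continuous (fun t : R => x + t *: delta_mx ord0 k).
Proof.
by move=> t; apply: cvgD; [exact: cvg_cst|apply: cvgZr_tmp; exact: cvg_id].
Qed.

Lemma sqr_increment_normc k x (s : R) : 0 < s ->
  (((Normc.normc (u (x + s *: delta_mx ord0 k)) - Normc.normc (u x)) ^+ 2)%:E <=
   s%:E * \int[mu]_(t in `[0%R, s])
     (Normc.normc (Dsmooth A k u (x + t *: delta_mx ord0 k)) ^+ 2)%:E)%E.
Proof.
move=> s0; set e := delta_mx ord0 k.
have cD : continuous (fun t : R => Normc.normc (Dsmooth A k u (x + t *: e)) ^+ 2).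
  by move=> t; exact: (@continuous_comp _ _ _ (fun t : R => x + t *: e)
    (fun y => Normc.normc (Dsmooth A k u y) ^+ 2) t
    (@continuous_line x k t) (@continuous_sqr_Dsmooth k _)).
have int : mu.-integrable `[0, s]
    (EFin \o (fun t : R => Normc.normc (Dsmooth A k u (x + t *: e)) ^+ 2)).
  apply: continuous_compact_integrable; first exact: segment_compact.
  exact: continuous_subspaceT.
have := integrable_fin_num _ int => /(_ _)/fineK <- //.
rewrite -EFinM lee_fin.
pose a := (@complex.Re R \o u); pose b := (@complex.Im R \o u).
have := @diamagnetic_line R (fun t => a (x + t *: e)) (fun t => b (x + t *: e))
  (fun t => pderiv k a (x + t *: e)) (fun t => pderiv k b (x + t *: e))
  (fun t => A (x + t *: e) ord0 k) s s0.
rewrite scale0r addr0 !normcE2.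
under [in X in _ -> _ <= s * X]eq_integral do rewrite /= sqr_normc_Dsmooth.
have cl (f : X -> R) : continuous f -> continuous (fun t : R => f (x + t *: e)).
  move=> cf t.
  exact: (@continuous_comp _ _ _ (fun t : R => x + t *: e) f t
    (@continuous_line x k t) (cf _)).
apply.
- by move=> t; apply: is_derive_line; have [_] := su [::]; apply.
- by move=> t; apply: is_derive_line; have [_] := sv [::]; apply.
- by apply: cl; have [] := su [:: k].
- by apply: cl; have [] := sv [:: k].
- by apply: (cl (fun x => A x ord0 k)); exact: cA.
Qed.

Lemma measurable_normc : measurable_fun setT (fun x : X => Normc.normc (u x)).
Proof. exact: (continuous_measurable_rV continuous_normc). Qed.

Lemma measurable_sqr_Dsmooth k :
  measurable_fun setT (fun x : X => Normc.normc (Dsmooth A k u x) ^+ 2).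
Proof. exact: (continuous_measurable_rV (@continuous_sqr_Dsmooth k)). Qed.

(** One factor s comes from Cauchy-Schwarz on the segment, the other from [integral_line], that is
    from averaging the segments over all base points. *)
Lemma sqr_shift_integral_le k (s : R) : 0 <= s ->
  (\int[leb n]_x ((Normc.normc (u (x + s *: delta_mx ord0 k)) - Normc.normc (u x)) ^+ 2)%:E
   <= (s ^+ 2)%:E * \int[leb n]_x (Normc.normc (Dsmooth A k u x) ^+ 2)%:E)%E.
Proof.
rewrite le_eqVlt => /predU1P[<-|s0].
  under eq_integral do rewrite scale0r addr0 subrr expr0n/=.
  by rewrite integral0 expr0n/= mul0e.
set e := delta_mx ord0 k.
have mD : measurable_fun setT (fun x => (Normc.normc (Dsmooth A k u x) ^+ 2)%:E).
  by apply/measurable_EFinP; exact: measurable_sqr_Dsmooth.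
have D0 x : (0 <= (Normc.normc (Dsmooth A k u x) ^+ 2)%:E)%E.
  by rewrite lee_fin sqr_ge0.
rewrite expr2 EFinM -muleA -(integral_line k s0 mD D0) -ge0_integralZl_EFin//; last 3 first.
- by move=> x _; exact: integral_ge0.
- exact: (measurable_integral_line _ _ mD D0).
- exact: ltW.
apply: ge0_le_integral => //.
- by move=> x _; rewrite lee_fin sqr_ge0.
- apply/measurable_EFinP; apply: measurable_funX; apply: measurable_funB.
    apply: (@measurableT_comp _ _ _ _ _ _ (fun x => Normc.normc (u x))).
      exact: measurable_normc.
    exact: measurable_rV_shift.
  exact: measurable_normc.
- by apply: measurable_funeM; exact: (measurable_integral_line _ _ mD D0).
- by move=> x _; exact: sqr_increment_normc.
Qed.

End shift_estimate.

(** * The weak-type estimate *)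

Lemma measurable_superlevel d (T : measurableType d) (R : realType)
    (f : T -> R) (t : R) :
  measurable_fun setT f -> measurable [set x | t < f x].
Proof.
move=> mf; rewrite (_ : mkset _ = setT `&` f @^-1` `]t, +oo[%classic).
  exact: mf.
by rewrite setTI; apply/seteqP; split=> x /=; rewrite in_itv/= andbT.
Qed.

Section weak_type.
Context {R : realType} (n : nat).
Local Notation X := 'rV[R]_n.
Variable f : X -> R.
Hypothesis mf : measurable_fun setT f.

Let msq (z : X) : measurable_fun setT (fun x : X => ((f (x + z) - f x) ^+ 2)%:E).
Proof.
apply/measurable_EFinP; apply: measurable_funX; apply: measurable_funB => //.
by apply: measurableT_comp => //; exact: measurable_rV_shift.
Qed.

Section cube_shift.
Variables (delta K : R) (z : X).
Hypotheses (K0 : 0 <= K)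
  (fK : forall k s, 0 <= s ->
    (\int[leb n]_x ((f (x + s *: delta_mx ord0 k)%R - f x) ^+ 2)%:E <=
     (s ^+ 2 * K)%:E)%E)
  (zd : forall k, 0 <= z ord0 k <= delta).

(** The shift z is performed one coordinate at a time; each step uses (u + v)^2 <= 2 u^2 + 2 v^2 and
    translation invariance. *)
Lemma sqr_shift_cube_le :
  (\int[leb n]_x ((f (x + z)%R - f x) ^+ 2)%:E <= (4 ^+ n * delta ^+ 2 * K)%:E)%E.
Proof.
have nE : n = size (index_enum 'I_n).
  by rewrite -sum1_size big_const_ord iter_addn mul1n addn0.
(* The exponent becomes the length of the list of coordinates already moved, so that the induction
   runs over that list. *)
rewrite [in X in (_ <= (4 ^+ X * _ * _)%:E)%E]nE [z]row_sum_delta.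
elim: (index_enum 'I_n) => [|k r IH].
  rewrite big_nil; under eq_integral do rewrite addr0 subrr expr0n/=.
  by rewrite integral0 lee_fin mulr_ge0// mulr_ge0 ?sqr_ge0// exprn_ge0.
rewrite big_cons; set a := z ord0 k *: _; set b := \sum_(_ <- _) _ in IH *.
have m1 : measurable_fun setT (fun x : X => (2 * (f (x + a + b) - f (x + a)) ^+ 2)%:E).
  apply/measurable_EFinP; apply: measurable_funM => //.
  have /measurable_EFinP h := msq b.
  exact: (measurableT_comp h (@measurable_rV_shift R n a)).
have m2 : measurable_fun setT (fun x : X => (2 * (f (x + a) - f x) ^+ 2)%:E).
  by apply/measurable_EFinP; apply: measurable_funM => //; apply/measurable_EFinP; exact: msq.
apply: (@le_trans _ _ (\int[leb n]_x ((2 * (f (x + a + b)%R - f (x + a)%R) ^+ 2)%:E +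
    (2 * (f (x + a)%R - f x) ^+ 2)%:E))%E).
  apply: ge0_le_integral => //.
  - by move=> x _; rewrite lee_fin sqr_ge0.
  - exact: emeasurable_funD.
  - move=> x _; rewrite -EFinD lee_fin addrA.
    set u := f _; set v := f (x + a); set w := f x.
    have := sqr_ge0 (u - v - (v - w)); lra.
have p1 x : (0 <= (2 * (f (x + a + b) - f (x + a)) ^+ 2)%:E)%E.
  by rewrite lee_fin mulr_ge0// sqr_ge0.
have p2 x : (0 <= (2 * (f (x + a) - f x) ^+ 2)%:E)%E.
  by rewrite lee_fin mulr_ge0// sqr_ge0.
rewrite (ge0_integralD _ _ (fun x _ => p1 x) m1 (fun x _ => p2 x) m2)//.
rewrite (@integral_shift R n a (fun x => (2 * (f (x + b) - f x) ^+ 2)%:E)); last 2 first.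
  by apply/measurable_EFinP; apply: measurable_funM => //; apply/measurable_EFinP; exact: msq.
  by move=> x; rewrite lee_fin mulr_ge0// sqr_ge0.
have dbl c : (\int[leb n]_x (2 * (f (x + c)%R - f x) ^+ 2)%:E =
    2%:E * \int[leb n]_x ((f (x + c)%R - f x) ^+ 2)%:E)%E.
  rewrite -(ge0_integralZl_EFin (leb n) measurableT _ (msq c))//.
  by move=> x _; rewrite lee_fin sqr_ge0.
rewrite !dbl.
have /andP[z0 zd'] := zd k.
have Ia := fK k z0.
apply: (@le_trans _ _ (2%:E * (4 ^+ size r * delta ^+ 2 * K)%:E +
    2%:E * (delta ^+ 2 * K)%:E))%E.
  apply: leeD; apply: lee_wpmul2l; rewrite ?lee_fin//.
  apply: le_trans Ia _; rewrite lee_fin ler_wpM2r// ler_pXn2r ?nnegrE//.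
  exact: le_trans z0 zd'.
(* The recursion multiplies the constant by 2 and adds 2; base 4 suffices because 2 * 4^r + 2 <=
   4^(r+1). *)
rewrite -!EFinM -EFinD lee_fin /= (exprS 4).
have : 0 <= delta ^+ 2 * K by rewrite mulr_ge0 ?sqr_ge0.
have : (1 : R) <= 4 ^+ size r by rewrite exprn_ege1// ler1n.
move=> q1 d0.
have : 0 <= (4 ^+ size r - 1) * (delta ^+ 2 * K) by rewrite mulr_ge0// subr_ge0.
lra.
Qed.

End cube_shift.

Section overlap.
Variables (E F : set X).
Hypotheses (mE : measurable E) (mF : measurable F).
Let H (p : X * X) : \bar R := ((\1_E p.1)%:E * (\1_F (p.1 + p.2)%R)%:E)%E.

Let mI (D : set X) : measurable D -> measurable_fun setT (fun x => (\1_D x)%:E : \bar R).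
Proof. by move=> mD; apply/measurable_EFinP; exact: measurable_indic. Qed.

Let mH : measurable_fun setT H.
Proof.
have madd : measurable_fun setT (fun p : X * X => p.1 + p.2).
  apply: measurable_fun_rV => i; under eq_fun do rewrite mxE.
  apply: measurable_funD.
    by apply: (measurableT_comp (measurable_coord i)); exact: measurable_fst.
  by apply: (measurableT_comp (measurable_coord i)); exact: measurable_snd.
apply: emeasurable_funM.
  exact: (measurableT_comp (mI mE) (@measurable_fst _ _ X X)).
exact: (measurableT_comp (mI mF) madd).
Qed.

Let H0 p : (0 <= H p)%E. Proof. by rewrite mule_ge0// lee_fin. Qed.

Let measurable_shift_preimage z : measurable ((fun x : X => x + z) @^-1` F).
Proof. by rewrite -[X in measurable X]setTI; exact: measurable_rV_shift. Qed.

Let HE z : leb n (E `&` (fun x => x + z)%R @^-1` F) = (\int[leb n]_x H (x, z))%E.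
Proof.
rewrite -[X in leb n X]setIT -integral_indic//; last exact: measurableI.
by apply: eq_integral => x _; rewrite /H /= -EFinM indicI.
Qed.

Lemma measurable_overlap :
  measurable_fun setT (fun z : X => leb n (E `&` (fun x => x + z)%R @^-1` F)).
Proof.
under eq_fun do rewrite HE.
exact: (measurable_fun_fubini_tonelli_G H mH H0).
Qed.

(** For fixed x in E the point x + z sweeps out F exactly once as z varies. This bounds the average
    over a cube of the part of E which the shift sends into F. *)
Lemma integral_overlap :
  (\int[leb n]_z leb n (E `&` (fun x => x + z)%R @^-1` F) = leb n E * leb n F)%E.
Proof.
under eq_integral do rewrite HE.
rewrite -(fubini_tonelli H mH H0).
have E1 x : (\int[leb n]_z H (x, z) = (\1_E x)%:E * leb n F)%E.
  have Ez z : (\1_F (x + z))%:E = (\1_F (z + x))%:E :> \bar R by rewrite addrC.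
  rewrite /H /=; under eq_integral do rewrite Ez.
  rewrite (ge0_integralZl (leb n) measurableT
    (measurableT_comp (mI mF) (@measurable_rV_shift R n x))); last 2 first.
  - by move=> z _; rewrite lee_fin.
  - by rewrite lee_fin.
  congr (_ * _)%E.
  rewrite (@integral_shift R n x (fun y => (\1_F y)%:E))//; last exact: mI.
  by rewrite integral_indic// setIT.
under eq_integral do rewrite E1.
by rewrite ge0_integralZr ?integral_indic ?setIT//; exact: mI.
Qed.

End overlap.

Lemma measurable_box (a b : X) :
  measurable [set x : X | forall i, x ord0 i \in `[a ord0 i, b ord0 i]].
Proof.
rewrite (_ : mkset _ = \bigcap_(i : 'I_n)
    ((fun x : X => x ord0 i : measurableTypeR R) @^-1`
      `[a ord0 i, b ord0 i]%classic)); last first.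
  by apply/seteqP; split => [x h i _|x h i]; [exact: h|exact: h].
apply: fin_bigcap_measurable => // i _.
by rewrite -[X in measurable X]setTI; exact: measurable_coord.
Qed.

Lemma chebyshev_sqr (t L : R) : 0 < t -> (forall x, 0 <= f x) ->
  (\int[leb n]_x (f x ^+ 2)%:E <= L%:E)%E ->
  ((t ^+ 2)%:E * leb n [set x | (t < f x)%R] <= L%:E)%E.
Proof.
move=> t0 f0; apply: le_trans.
have mE := measurable_superlevel t mf.
rewrite -[X in leb n X]setIT -integral_indic// -ge0_integralZl_EFin//; last 2 first.
- by apply/measurable_EFinP; exact: measurable_indic.
- exact: sqr_ge0.
apply: ge0_le_integral => //.
- by move=> x _; rewrite -EFinM lee_fin mulr_ge0 ?sqr_ge0.
- by apply: measurable_funeM; apply/measurable_EFinP; exact: measurable_indic.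
- by apply/measurable_EFinP; exact: measurable_funX.
- move=> x _; rewrite -EFinM lee_fin indicE.
  case: (boolP (x \in _)) => [|_]; last by rewrite mulr0 sqr_ge0.
  by rewrite inE/= => tf; rewrite mulr1 ler_pXn2r ?nnegrE// ltW// (ltW t0).
Qed.

(* Averaging over a cube Q of side [delta] with [leb Q = 2 L / lambda ^ 2]: for
   x in {f > 2 lambda} at least half of the points x + z, z in Q, satisfy
   f (x + z) <= lambda, whence |f (x + z) - f x| > lambda there. *)
Lemma weak_type (K L lambda : R) : (0 < n)%N -> 0 <= K -> 0 < L -> 0 < lambda ->
  (forall x, 0 <= f x) ->
  (forall k s, 0 <= s ->
    (\int[leb n]_x ((f (x + s *: delta_mx ord0 k)%R - f x) ^+ 2)%:E <=
     (s ^+ 2 * K)%:E)%E) ->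
  (\int[leb n]_x (f x ^+ 2)%:E <= L%:E)%E ->
  (leb n [set x | (2 * lambda < f x)%R] <=
   (2 * 4 ^+ n * (2 * L) `^ (2 / n%:R) * K * lambda `^ (- (2 + 4 / n%:R)))%:E)%E.
Proof.
move=> n0 K0 L0 l0 f0 fK fL.
set E := [set x | _]; pose F := [set x | lambda < f x].
have mE : measurable E by exact: measurable_superlevel.
have mF : measurable F by exact: measurable_superlevel.
have l2 : 0 < lambda ^+ 2 by rewrite exprn_gt0.
have EF : (leb n E <= leb n F)%E.
  apply: le_measure; rewrite ?inE//.
  by move=> x; rewrite /E /F /=; apply: le_lt_trans; lra.
have FL := chebyshev_sqr l0 f0 fL; rewrite -/F in FL.
have Ffin : leb n F \is a fin_num.
  rewrite ge0_fin_numE//; apply: contraTT FL; rewrite -leNgt leye_eq => /eqP ->.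
  by rewrite gt0_muley ?lte_fin// -ltNge ltry.
have Efin : leb n E \is a fin_num.
  by rewrite ge0_fin_numE//; apply: le_lt_trans EF _; rewrite -ge0_fin_numE.
pose e := fine (leb n E); pose p := fine (leb n F).
have e0 : 0 <= e by exact: fine_ge0.
have Ee : leb n E = e%:E by rewrite fineK.
have Fe : leb n F = p%:E by rewrite fineK.
pose delta : R := (2 * L / lambda ^+ 2) `^ n%:R^-1.
have d0 : 0 < delta by rewrite powR_gt0// divr_gt0// mulr_gt0.
have n0' : (n%:R : R) != 0 by rewrite pnatr_eq0 -lt0n.
have dn : delta ^+ n = 2 * L / lambda ^+ 2.
  rewrite -powR_mulrn ?ltW// -powRrM mulVf// powRr1// divr_ge0 ?mulr_ge0//; exact: ltW.
pose Q := [set z : X | forall i, z ord0 i \in `[(0 : X) ord0 i, (const_mx delta : X) ord0 i]].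
have mQ : measurable Q by exact: measurable_box.
have Qd : leb n Q = (delta ^+ n)%:E.
  rewrite leb_box; last by move=> i; rewrite !mxE ltW.
  congr (_%:E); under eq_bigr do rewrite !mxE subr0.
  by rewrite prodr_const card_ord.
pose c := 4 ^+ n * delta ^+ 2 * K.
have c0 : 0 <= c by rewrite !mulr_ge0 ?exprn_ge0// ltW.
pose ov z := leb n (E `&` (fun x => x + z)%R @^-1` F).
have mov : measurable_fun setT ov by exact: measurable_overlap.
(* For x in E either x + z lies in F, which the overlap counts, or f (x + z) <= lambda and the
   increment exceeds lambda. *)
have step z : Q z -> ((lambda ^+ 2 * e)%:E <= c%:E + (lambda ^+ 2)%:E * ov z)%E.
  move=> Qz.
  have mEz : measurable (E `&` (fun x => x + z) @^-1` F).
    apply: measurableI => //; rewrite -[X in measurable X]setTI.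
    exact: measurable_rV_shift.
  have zd k : 0 <= z ord0 k <= delta by have := Qz k; rewrite !mxE in_itv.
  apply: (@le_trans _ _ (\int[leb n]_x ((f (x + z)%R - f x) ^+ 2)%:E +
      (lambda ^+ 2)%:E * ov z))%E; last first.
    by apply: leeD => //; exact: sqr_shift_cube_le fK zd.
  have mi (D : set X) : measurable D ->
      measurable_fun setT (fun x => (lambda ^+ 2)%:E * (\1_D x)%:E : \bar R)%E.
    by move=> mD; apply: measurable_funeM; apply/measurable_EFinP; exact: measurable_indic.
  have i0 (D : set X) x : (0 <= (lambda ^+ 2)%:E * (\1_D x)%:E :> \bar R)%E.
    by rewrite -EFinM lee_fin mulr_ge0// ltW.
  have iE (D : set X) : measurable D ->
      (\int[leb n]_x ((lambda ^+ 2)%:E * (\1_D x)%:E) = (lambda ^+ 2)%:E * leb n D)%E.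
    move=> mD; rewrite ge0_integralZl_EFin//; last 2 first.
    - by apply/measurable_EFinP; exact: measurable_indic.
    - exact: ltW.
    by rewrite integral_indic// setIT.
  rewrite EFinM -Ee -(iE _ mE) -(iE _ mEz).
  have q0 x : (0 <= ((f (x + z) - f x) ^+ 2)%:E)%E by rewrite lee_fin sqr_ge0.
  rewrite -(ge0_integralD _ _ (fun x _ => q0 x) (msq z) (fun x _ => i0 _ x) (mi _ mEz))//.
  apply: ge0_le_integral => //; [exact: mi|by apply: emeasurable_funD => //; exact: mi|].
  move=> x _; rewrite -!EFinM -EFinD lee_fin !indicE.
  case: (boolP (x \in E)) => [|_]; last first.
    by rewrite mulr0 addr_ge0 ?sqr_ge0// mulr_ge0// ltW.
  rewrite inE /E /= => xE; rewrite mulr1.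
  have [xF|xF] := ltP lambda (f (x + z)).
    by rewrite mem_set//= mulr1 lerDr sqr_ge0.
  have h : 0 <= lambda ^+ 2 * (x \in E `&` (fun x => x + z) @^-1` F)%:R.
    by rewrite mulr_ge0// ltW.
  suff : lambda ^+ 2 <= (f (x + z) - f x) ^+ 2 by lra.
  nra.
(* The previous inequality is integrated over Q; enlarging Q to the whole space in the overlap term
   gives |E| |F| by [integral_overlap]. *)
have main : ((lambda ^+ 2 * e * delta ^+ n)%:E <=
    (c * delta ^+ n + lambda ^+ 2 * (e * p))%:E)%E.
  have -> : ((lambda ^+ 2 * e * delta ^+ n)%:E =
      \int[leb n]_(z in Q) (cst (lambda ^+ 2 * e)%:E) z)%E.
    by transitivity ((lambda ^+ 2 * e)%:E * leb n Q)%E; [rewrite Qd|rewrite integral_cst].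
  apply: (@le_trans _ _ (\int[leb n]_(z in Q) (c%:E + (lambda ^+ 2)%:E * ov z)))%E.
    apply: ge0_le_integral => //.
    - by move=> z _; rewrite lee_fin mulr_ge0// ltW.
    - apply: emeasurable_funD => //; apply: measurable_funeM.
      exact: measurable_funTS.
  have o0 z : (0 <= (lambda ^+ 2)%:E * ov z)%E by rewrite mule_ge0// lee_fin ltW.
  have mo : measurable_fun Q (fun z => (lambda ^+ 2)%:E * ov z)%E.
    by apply: measurable_funeM; exact: measurable_funTS.
  rewrite ge0_integralD//.
  have -> : (\int[leb n]_(z in Q) c%:E = (c * delta ^+ n)%:E)%E.
    by transitivity (c%:E * leb n Q)%E; [rewrite integral_cst|rewrite Qd].
  rewrite EFinD leeD// !EFinM ge0_integralZl_EFin//; last 2 first.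
  - exact: measurable_funTS.
  - exact: ltW.
  apply: lee_wpmul2l; first by rewrite lee_fin ltW.
  rewrite -Ee -Fe -(integral_overlap mE mF).
  exact: ge0_subset_integral.
rewrite Ee lee_fin.
move: FL; rewrite Fe -EFinM lee_fin => FL.
move: main; rewrite lee_fin => main.
have h1 : lambda ^+ 2 * delta ^+ n = 2 * L.
  by rewrite dn mulrC divfK// gt_eqF.
(* Since lambda^2 delta^n = 2 L while lambda^2 |F| <= L by Chebyshev, the overlap term is at most
   half of the left-hand side and is absorbed. This is the reason for the 2 in the volume of Q. *)
have h2 : e * lambda ^+ 2 <= 2 * c.
  have : 2 * L * e <= c * delta ^+ n + e * L.
    have : e * (lambda ^+ 2 * p) <= e * L by rewrite ler_wpM2l.
    by move: main; rewrite -h1; lra.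
  rewrite dn => h.
  have h3 : L * (e * lambda ^+ 2) <= L * (2 * c).
    have -> : L * (2 * c) = (c * (2 * L / lambda ^+ 2)) * lambda ^+ 2.
      by field; rewrite gt_eqF.
    have -> : L * (e * lambda ^+ 2) = (L * e) * lambda ^+ 2 by ring.
    by rewrite ler_pM2r//; lra.
  by rewrite ler_pM2l in h3.
(* The side of the cube supplies the extra decay lambda^(-4/n), which turns the Chebyshev exponent 2
   into 2 + 4/n. *)
have d2 : delta ^+ 2 = (2 * L) `^ (2 / n%:R) * lambda `^ (- (4 / n%:R)).
  rewrite /delta -powR_mulrn ?powR_ge0// -powRrM.
  rewrite powRM ?mulr_ge0 ?invr_ge0 ?(ltW l2) ?(ltW L0)//.
  have -> : lambda ^- 2 = lambda `^ (- 2%:R) by rewrite powRN powR_mulrn// ltW.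
  rewrite -powRrM; congr (_ `^ _ * _ `^ _); first by rewrite mulrC.
  by field.
rewrite -(ler_pM2r l2); apply: (le_trans h2).
rewrite /c d2 opprD powRD; last by apply/implyP => _; rewrite gt_eqF.
rewrite -[in leRHS](powR_mulrn 2 (ltW l0)).
have -> : lambda `^ (- 2) = (lambda `^ 2%:R)^-1 by rewrite powRN.
have : lambda `^ 2%:R != 0 by rewrite gt_eqF// powR_gt0.
set a := lambda `^ 2%:R; set b := lambda `^ _; set d := _ `^ _ => a0.
rewrite le_eqVlt; apply/orP; left; apply/eqP; by field.
Qed.

End weak_type.

(** * Passage from test functions to H^1_A *)

Section magnetic_weak_type.
Context {R : realType} (n : nat).
Local Notation X := 'rV[R]_n.
Implicit Types (u v w : X -> R[i]).

Definition cmeasurable w := measurable_fun setT (@complex.Re R \o w) /\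
  measurable_fun setT (@complex.Im R \o w).

Lemma cmeasurable_normc w : cmeasurable w ->
  measurable_fun setT (fun x : X => Normc.normc (w x)).
Proof.
move=> [mr mi]; under eq_fun do rewrite normcE2.
apply: (@measurableT_comp _ _ _ _ _ _ (@Num.sqrt R)).
  exact: continuous_measurable_fun (@sqrt_continuous R).
by apply: measurable_funD; apply: measurable_funX.
Qed.

Lemma cmeasurableB v w : cmeasurable v -> cmeasurable w ->
  cmeasurable (fun x => v x - w x).
Proof.
have ReB : @complex.Re R \o (fun x => v x - w x) =
    (fun x => complex.Re (v x) - complex.Re (w x)).
  by apply/funext => x /=; case: (v x) => a b; case: (w x).
have ImB : @complex.Im R \o (fun x => v x - w x) =
    (fun x => complex.Im (v x) - complex.Im (w x)).
  by apply/funext => x /=; case: (v x) => a b; case: (w x).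
by move=> [? ?] [? ?]; split; rewrite ?ReB ?ImB; exact: measurable_funB.
Qed.

Lemma integral_sqr_normc w : (L2norm w < +oo)%E ->
  (\int[leb n]_x (Normc.normc (w x) ^+ 2)%:E = (fine (L2norm w) ^+ 2)%:E)%E.
Proof.
move=> wfin; have w0 : (0 <= L2norm w)%E by exact: Lnorm_ge0.
transitivity (L2norm w `^ 2)%E.
  rewrite /L2norm poweR_Lnorm; last by rewrite pnatr_eq0.
  apply: eq_integral => x _; rewrite /= ger0_norm ?normc_ge0//.
  by rewrite powR_mulrn ?normc_ge0.
move: wfin w0; case: (L2norm w) => [r||]//= _; rewrite lee_fin => r0.
by rewrite powR_mulrn.
Qed.

Lemma integral_sqr_normc_le v w : cmeasurable v -> cmeasurable w ->
  (\int[leb n]_x (Normc.normc (v x) ^+ 2)%:E <=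
   2%:E * \int[leb n]_x (Normc.normc (w x) ^+ 2)%:E +
   2%:E * \int[leb n]_x (Normc.normc (v x - w x) ^+ 2)%:E)%E.
Proof.
move=> mv mw.
have ms u : cmeasurable u -> measurable_fun setT (fun x => (Normc.normc (u x) ^+ 2)%:E).
  by move=> mu; apply/measurable_EFinP; apply: measurable_funX; exact: cmeasurable_normc.
have s0 u x : (0 <= (Normc.normc (u x) ^+ 2)%:E)%E by rewrite lee_fin sqr_ge0.
have m1 := ms _ mw; have m2 := ms _ (cmeasurableB mv mw).
have d0 u x : (0 <= 2%:E * (Normc.normc (u x) ^+ 2)%:E)%E by rewrite mule_ge0.
rewrite -(ge0_integralZl_EFin (leb n) measurableT (fun x _ => s0 w x) m1)//.
rewrite -(ge0_integralZl_EFin (leb n) measurableT (fun x _ => s0 (fun x => v x - w x) x) m2)//.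
rewrite -(ge0_integralD (leb n) measurableT (fun x _ => d0 w x) _
  (fun x _ => d0 (fun x => v x - w x) x) _); last 2 first.
- exact: measurable_funeM.
- exact: measurable_funeM.
apply: ge0_le_integral => //.
- exact: ms.
- by apply: emeasurable_funD; exact: measurable_funeM.
move=> x _; rewrite -!EFinM -EFinD lee_fin.
have := le_normcD (w x) (v x - w x); rewrite [w x + _]addrC subrK.
have := normc_ge0 (v x); set a := Normc.normc _; set b := Normc.normc _; set c := Normc.normc _.
move=> a0 abc; have : a ^+ 2 <= (b + c) ^+ 2 by rewrite ler_pXn2r ?nnegrE// (le_trans a0).
have := sqr_ge0 (b - c); lra.
Qed.

Section smooth.
Variables (A : X -> X) (u : X -> R[i]).
Hypotheses (cA : forall k, continuous (fun x => A x ord0 k))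
  (su : smooth (@complex.Re R \o u)) (sv : smooth (@complex.Im R \o u)).

Lemma cmeasurable_smooth : cmeasurable u.
Proof.
split; apply: continuous_measurable_rV.
  exact: (continuous_Re su).
exact: (continuous_Im sv).
Qed.

Lemma DsmoothE k x : Dsmooth A k u x =
  ((pderiv k (@complex.Im R \o u) x - A x ord0 k * complex.Re (u x)) +i*
  (- pderiv k (@complex.Re R \o u) x - A x ord0 k * complex.Im (u x)))%C.
Proof.
rewrite /Dsmooth; case: (u x) => a b /=.
set p := pderiv _ _ _; set q := pderiv _ _ _; set c := A x ord0 k.
by simpc; apply/eqP; rewrite eq_complex /=; apply/andP; split; apply/eqP; field.
Qed.

Lemma cmeasurable_Dsmooth k : cmeasurable (Dsmooth A k u).
Proof.
have cp : continuous (pderiv k (@complex.Re R \o u)) by have [] := su [:: k].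
have cq : continuous (pderiv k (@complex.Im R \o u)) by have [] := sv [:: k].
have mA : measurable_fun setT (fun x => A x ord0 k).
  exact: (continuous_measurable_rV (@cA k)).
have [mr mi] := cmeasurable_smooth.
have -> : Dsmooth A k u = fun x =>
  ((pderiv k (@complex.Im R \o u) x - A x ord0 k * complex.Re (u x)) +i*
  (- pderiv k (@complex.Re R \o u) x - A x ord0 k * complex.Im (u x)))%C.
  by apply/funext => x; exact: DsmoothE.
split; rewrite /comp /=; apply: measurable_funB.
- exact: (continuous_measurable_rV cq).
- exact: measurable_funM.
- by apply: measurable_funN; exact: (continuous_measurable_rV cp).
- exact: measurable_funM.
Qed.

End smooth.

(* A test function close to [u] has mass at most [2 * L + 2] and kinetic energy
   at most [2 * K + 2]. *)
Definition weak_constant (L : R) : R :=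
  2 * 4 ^+ n * (2 * (2 * L + 2)) `^ (2 / n%:R) * 2.

(** With phi a test function near u, {|u| > 3 lambda} is contained in {|phi| > 2 lambda} and {|phi -
    u| > lambda} together. The first set is controlled by [weak_type], the second has arbitrarily
    small measure. *)
Lemma magnetic_weak_type (A : X -> X) u (v : 'I_n -> X -> R[i]) (K L lambda : R) : (0 < n)%N ->
  (forall k, continuous (fun x => A x ord0 k)) -> is_magD A u v ->
  0 <= K -> 0 <= L -> 0 < lambda ->
  (forall k, fine (L2norm (v k)) ^+ 2 <= K) -> fine (L2norm u) ^+ 2 <= L ->
  (leb n [set x | (3 * lambda < Normc.normc (u x))%R] <=
   (weak_constant L * (1 + K) * lambda `^ (- (2 + 4 / n%:R)))%:E)%E.
Proof.
move=> n0 cA [[mur mui ufin] L2v [phi [Cphi phiu Dphi]]] K0 L0 l0 vK uL.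
have mu : cmeasurable u by [].
apply/lee_addgt0Pr => e e0.
have l2 : 0 < lambda ^+ 2 by rewrite exprn_gt0.
(* The bound eta <= 1 keeps the mass of phi below 2 L + 2; eta^2 <= e lambda^2 makes the Chebyshev
   error at most e. *)
pose eta := Num.min 1 (Num.sqrt (e * lambda ^+ 2)).
have eta0 : 0 < eta by rewrite lt_min ltr01 sqrtr_gt0 mulr_gt0.
have near1 : \forall N \near \oo, (L2norm (fun x => (phi N x - u x)%R) < eta%:E)%E.
  have eta0' : (0%E < eta%:E)%E by rewrite lte_fin.
  exact: (phiu [set y | (y < eta%:E)%E] (open_ereal_lt' eta0')).
(* For the gradients distance 1 is enough: it only enters the constant and need not shrink with
   e. *)
have near2 : \forall N \near \oo, forall k,
    (L2norm (fun x => (Dsmooth A k (phi N) x - v k x)%R) < 1)%E.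
  apply: filter_forall => k.
  have lt01 : (0%E < 1%:E :> \bar R)%E by rewrite lte_fin.
  exact: (Dphi k [set y | (y < 1%:E)%E] (open_ereal_lt' lt01)).
have [N [h1 h2]] := filter_ex (filterI near1 near2).
have [sr si _] := Cphi N.
have mphi : cmeasurable (phi N) by exact: cmeasurable_smooth.
have bound w t : (L2norm w < t%:E)%E -> 0 < t ->
    (\int[leb n]_x (Normc.normc (w x) ^+ 2)%:E <= (t ^+ 2)%:E)%E.
  move=> wt t0; have wfin : (L2norm w < +oo)%E by apply: lt_trans wt _; rewrite ltry.
  rewrite integral_sqr_normc// lee_fin ler_pXn2r ?nnegrE//; last 2 first.
  - by rewrite fine_ge0// Lnorm_ge0.
  - exact: ltW.
  rewrite -lee_fin fineK ?ltW// ge0_fin_numE// Lnorm_ge0//.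
pose f x := Normc.normc (phi N x).
have mf : measurable_fun setT f by exact: cmeasurable_normc.
have fL : (\int[leb n]_x (f x ^+ 2)%:E <= (2 * L + 2)%:E)%E.
  apply: le_trans (integral_sqr_normc_le mphi mu) _.
  rewrite [(2 * L + 2)%:E]EFinD; apply: leeD.
    by rewrite (integral_sqr_normc ufin) -EFinM lee_fin ler_pM2l.
  rewrite -[leRHS]mule1; apply: lee_wpmul2l => //; apply: le_trans (bound _ _ h1 eta0) _.
  by rewrite lee_fin; apply: exprn_ile1; [exact: ltW|rewrite /eta ge_min lexx].
have DK k : (\int[leb n]_x (Normc.normc (Dsmooth A k (phi N) x) ^+ 2)%:E <=
    (2 * K + 2)%:E)%E.
  have [mvr mvi vfin] := L2v k.
  have mD := @cmeasurable_Dsmooth A (phi N) cA sr si k.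
  apply: le_trans (integral_sqr_normc_le mD (conj mvr mvi)) _.
  rewrite [(2 * K + 2)%:E]EFinD; apply: leeD.
    by rewrite (integral_sqr_normc vfin) -EFinM lee_fin ler_pM2l.
  rewrite -[leRHS]mule1; apply: lee_wpmul2l => //; apply: le_trans (bound _ 1 (h2 k) ltr01) _.
  by rewrite expr1n.
have fK k s : 0 <= s ->
    (\int[leb n]_x ((f (x + s *: delta_mx ord0 k)%R - f x) ^+ 2)%:E <=
     (s ^+ 2 * (2 * K + 2))%:E)%E.
  move=> s0; apply: le_trans (sqr_shift_integral_le cA sr si k s0) _.
  by rewrite [leRHS]EFinM; apply: lee_wpmul2l; rewrite ?lee_fin ?sqr_ge0.
have K2 : 0 <= 2 * K + 2 by rewrite addr_ge0// mulr_ge0.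
have L2 : 0 < 2 * L + 2 by rewrite ltr_wpDl// mulr_ge0.
have W := weak_type mf n0 K2 L2 l0 (fun x => normc_ge0 _) fK fL.
pose w x := Normc.normc (phi N x - u x).
have mw : measurable_fun setT w by apply: cmeasurable_normc; exact: cmeasurableB.
have Ch := chebyshev_sqr mw l0 (fun x => normc_ge0 _) (bound _ _ h1 eta0).
have sub : [set x | 3 * lambda < Normc.normc (u x)] `<=`
    [set x | 2 * lambda < f x] `|` [set x | lambda < w x].
  move=> x /= xu; have := le_normcD (phi N x) (u x - phi N x).
  rewrite [phi N x + _]addrC subrK -[Normc.normc (u x - _)]normcN opprB.
  rewrite -/(f x) -/(w x) => fw.
  by have [?|?] := ltP (2 * lambda) (f x); [left|right; lra].
apply: (@le_trans _ _ (leb n ([set x | (2 * lambda < f x)%R] `|` [set x | (lambda < w x)%R]))).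
  apply: le_measure; rewrite ?inE//.
  - exact: (measurable_superlevel _ (cmeasurable_normc mu)).
  - by apply: measurableU; exact: measurable_superlevel.
apply: le_trans (measureU2 _ _ _) _; try exact: measurable_superlevel.
apply: leeD.
  apply: le_trans W _; rewrite lee_fin /weak_constant le_eqVlt; apply/orP; left.
  by apply/eqP; ring.
rewrite -(@lee_pmul2l _ (lambda ^+ 2)%:E)//; apply: le_trans Ch _.
rewrite -EFinM lee_fin mulrC -[leRHS]sqr_sqrtr ?mulr_ge0 ?(ltW e0) ?(ltW l0)//.
by rewrite ler_pXn2r ?nnegrE ?sqrtr_ge0 ?(ltW eta0)// /eta ge_min lexx orbT.
Qed.

End magnetic_weak_type.

(** * Moments *)

Section moments.
Context d (T : measurableType d) (R : realType) (mu : {measure set T -> \bar R}).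
Variable f : T -> R.
Hypotheses (mf : measurable_fun setT f) (f0 : forall x, 0 <= f x).

Let mE t : measurable [set x | t < f x].
Proof. exact: measurable_superlevel. Qed.

Lemma dyadic_level (lambda t : R) : 0 < lambda -> lambda < t ->
  exists k, 2 ^+ k * lambda < t /\ t <= 2 ^+ k.+1 * lambda.
Proof.
move=> l0 lt.
have ex : exists k, t <= 2 ^+ k.+1 * lambda.
  have [k kt] : exists k : nat, t / lambda <= k%:R.
    by exists (Num.bound (t / lambda)); apply: ltW; apply: archi_boundP;
      rewrite divr_ge0 ?(ltW l0)// (le_trans (ltW l0))// ltW.
  exists k; rewrite -ler_pdivrMr//; apply: (le_trans kt).
  by rewrite -natrX ler_nat; apply: ltnW; apply: ltnW; exact: ltn_expl.
case: (ex_minnP ex) => k tk mink; exists k; split => //.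
case: k tk mink => [|k] tk mink; first by rewrite expr0 mul1r.
rewrite ltNge; apply/negP => /mink; by rewrite ltnn.
Qed.

Lemma powR2_lt1 (p P : R) : p < P -> 2 `^ (p - P) < 1 :> R.
Proof.
move=> pP; rewrite -opprB powRN invf_lt1 ?powR_gt0//.
have := @gt0_ltr_powR R (P - p) _ 1 2; rewrite powR1; apply.
- by rewrite subr_gt0.
- by rewrite nnegrE.
- by rewrite nnegrE.
- by rewrite ltr1n.
Qed.

(** The sum over k >= 0 of 2^((k+1) p) 2^(-k P): the upper end of each dyadic layer to the power p,
    against the weak bound at its lower end. *)
Definition tail_constant (p P : R) : R := 2 `^ p / (1 - 2 `^ (p - P)).

Lemma tail_constant_ge0 (p P : R) : p < P -> 0 <= tail_constant p P.
Proof.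
move=> pP; rewrite divr_ge0 ?powR_ge0// subr_ge0 -[leRHS](powRr0 2).
by rewrite powRr0 ltW// powR2_lt1.
Qed.

Lemma tail_moment_le (p P B lambda : R) : 0 <= p -> p < P -> 0 <= B -> 0 < lambda ->
  (forall t, lambda <= t -> (mu [set x | (t < f x)%R] <= (B * t `^ (- P))%:E)%E) ->
  (\int[mu]_x (f x `^ p * \1_[set x | (lambda < f x)%R] x)%:E <=
   (tail_constant p P * B * lambda `^ (p - P))%:E)%E.
Proof.
move=> p0 pP B0 l0 weak.
pose lv (k : nat) : R := 2 ^+ k * lambda.
have lv0 k : 0 < lv k by rewrite mulr_gt0// exprn_gt0.
(* The indicator is that of the whole superlevel set, not of the dyadic layer: it still dominates
   there, and the weak bound applies to it as it stands. *)
pose F (k : nat) x : \bar R := ((lv k.+1 `^ p)%:E * (\1_[set x | lv k < f x] x)%:E)%E.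
have F0 k x : (0 <= F k x)%E by rewrite /F -EFinM lee_fin mulr_ge0// powR_ge0.
have mI k : measurable_fun setT (fun x => (\1_[set x | lv k < f x] x)%:E : \bar R).
  by apply/measurable_EFinP; exact: measurable_indic.
have mF k : measurable_fun setT (F k) by apply: measurable_funeM.
apply: (@le_trans _ _ (\int[mu]_x (\sum_(0 <= k <oo) F k x)))%E.
  apply: ge0_le_integral => //.
  - by move=> x _; rewrite lee_fin mulr_ge0// powR_ge0.
  - apply/measurable_EFinP; apply: measurable_funM; last exact: measurable_indic.
    by apply: (measurableT_comp (measurable_powR p)).
  - by apply: ge0_emeasurable_sum => // k x _ _; exact: F0.
  - move=> x _; rewrite indicE; case: (boolP (x \in _)) => [|_]; last first.
      by rewrite mulr0; apply: nneseries_ge0 => k _ _; exact: F0.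
    rewrite inE/= => /(dyadic_level l0) [k [k1 k2]]; rewrite mulr1.
    apply: (@le_trans _ _ (F k x)).
      rewrite /F indicE mem_set//= -EFinM lee_fin mulr1.
      by rewrite ge0_ler_powR ?nnegrE// ltW.
    apply: le_trans (nneseries_lim_ge k.+1 _); last by move=> i _ _; exact: F0.
    by rewrite big_nat_recr//= leeDr// sume_ge0.
rewrite integral_nneseries//.
have z0 : 0 <= 2 `^ (p - P) :> R by exact: powR_ge0.
have z1 : 2 `^ (p - P) < 1 :> R.
  exact: powR2_lt1.
pose a := 2 `^ p * B * lambda `^ (p - P).
have a0 : 0 <= a by rewrite !mulr_ge0 ?powR_ge0.
apply: (@le_trans _ _ (\sum_(0 <= k <oo) (a * (2 `^ (p - P)) ^+ k)%:E)%E).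
  apply: lee_nneseries => [k _ _|k _]; first exact: integral_ge0.
  rewrite /F ge0_integralZl_EFin ?powR_ge0//.
  rewrite integral_indic// setIT.
  apply: (@le_trans _ _ ((lv k.+1 `^ p)%:E * (B * lv k `^ (- P))%:E)%E).
    apply: lee_wpmul2l; first by rewrite lee_fin powR_ge0.
    apply: weak; rewrite -[leLHS]mul1r ler_pM2r//.
    by rewrite exprn_ege1// ler1n.
  rewrite -EFinM lee_fin le_eqVlt; apply/orP; left; apply/eqP.
  have -> : lv k.+1 = 2 * lv k by rewrite /lv exprS mulrA.
  rewrite powRM ?(ltW (lv0 k))//.
  have E : (2 `^ (p - P)) ^+ k * lambda `^ (p - P) = lv k `^ p * lv k `^ (- P).
    rewrite -powRD; last by apply/implyP => _; rewrite gt_eqF.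
    rewrite /lv powRM ?exprn_ge0 ?(ltW l0)//; congr (_ * _).
    rewrite -[LHS]powR_mulrn ?powR_ge0// -powRrM mulrC powRrM.
    by rewrite powR_mulrn.
  have -> : a * 2 `^ (p - P) ^+ k = 2 `^ p * B * (2 `^ (p - P) ^+ k * lambda `^ (p - P)).
    by rewrite /a; ring.
  by rewrite E; ring.
apply: lime_le; first by apply: is_cvg_nneseries => k _ _; rewrite lee_fin mulr_ge0// exprn_ge0.
apply: nearW => k; rewrite sumEFin lee_fin.
have zn1 : 2 `^ (p - P) != 1 by rewrite lt_eqF.
have -> : \sum_(0 <= i < k) (a * 2 `^ (p - P) ^+ i) =
    a * (1 - 2 `^ (p - P) ^+ k) / (1 - 2 `^ (p - P)).
  by have := geometric_seriesE a zn1 => /(congr1 (fun u => u k)); rewrite /series /geometric/=.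
have -> : tail_constant p P * B * lambda `^ (p - P) = a / (1 - 2 `^ (p - P)).
  by rewrite /tail_constant /a; field; rewrite subr_eq0 eq_sym.
rewrite ler_pM2r ?invr_gt0 ?subr_gt0//.
rewrite -[leRHS]mulr1 ler_wpM2l// lerBlDr lerDl exprn_ge0//.
Qed.

(** Where f <= lambda, f^p <= lambda^(p-2) f^2 and the mass takes over; where f > lambda, the weak
    bound does. The level lambda is left free for later optimisation. *)
Lemma moment_le (p P L B lambda : R) : 2 <= p -> p < P -> 0 <= B -> 0 < lambda ->
  (\int[mu]_x (f x ^+ 2)%:E <= L%:E)%E ->
  (forall t, 0 < t -> (mu [set x | (t < f x)%R] <= (B * t `^ (- P))%:E)%E) ->
  (\int[mu]_x (f x `^ p)%:E <=
   (lambda `^ (p - 2) * L + tail_constant p P * B * lambda `^ (p - P))%:E)%E.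
Proof.
move=> p2 pP B0 l0 fL weak.
have p0 : 0 <= p by rewrite (le_trans _ p2).
have m1 : measurable_fun setT (fun x => (f x ^+ 2)%:E).
  by apply/measurable_EFinP; exact: measurable_funX.
have m2 : measurable_fun setT (fun x => (f x `^ p * \1_[set x | (lambda < f x)%R] x)%:E).
  apply/measurable_EFinP; apply: measurable_funM; last exact: measurable_indic.
  by apply: (measurableT_comp (measurable_powR p)).
have q1 x : (0 <= (f x ^+ 2)%:E)%E by rewrite lee_fin sqr_ge0.
have q2 x : (0 <= (f x `^ p * \1_[set x | (lambda < f x)%R] x)%:E)%E.
  by rewrite lee_fin mulr_ge0// powR_ge0.
apply: (@le_trans _ _ (\int[mu]_x ((lambda `^ (p - 2))%:E * (f x ^+ 2)%:E +
    (f x `^ p * \1_[set x | (lambda < f x)%R] x)%:E))%E).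
  apply: ge0_le_integral => //.
  - by move=> x _; rewrite lee_fin powR_ge0.
  - by apply/measurable_EFinP; apply: (measurableT_comp (measurable_powR p)).
  - by apply: emeasurable_funD => //; exact: measurable_funeM.
  - move=> x _; rewrite -EFinM -EFinD lee_fin indicE.
    have [lf|fl] := ltP lambda (f x).
      by rewrite mem_set// mulr1 lerDr mulr_ge0 ?powR_ge0 ?sqr_ge0.
    apply: (@le_trans _ _ (lambda `^ (p - 2) * f x ^+ 2)); last first.
      by rewrite lerDl mulr_ge0// powR_ge0.
    have -> : f x `^ p = f x `^ (p - 2) * f x ^+ 2.
      have [->|fx] := eqVneq (f x) 0.
        rewrite expr0n/= mulr0 powR0// gt_eqF//; lra.
      rewrite -powR_mulrn// -powRD ?subrK//.
      by apply/implyP.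
    rewrite ler_wpM2r ?sqr_ge0// ge0_ler_powR ?nnegrE ?subr_ge0//; lra.
rewrite ge0_integralD//; last 2 first.
- by move=> x _; rewrite mule_ge0// lee_fin powR_ge0.
- exact: measurable_funeM.
rewrite ge0_integralZl_EFin ?powR_ge0// [leRHS]EFinD; apply: leeD.
  by rewrite [leRHS]EFinM; apply: lee_wpmul2l => //; rewrite lee_fin powR_ge0.
apply: tail_moment_le => // t lt; apply: weak; exact: lt_le_trans lt.
Qed.

End moments.

Section magnetic_moments.
Context {R : realType} (n : nat).
Local Notation X := 'rV[R]_n.

(* Taking [lambda ^ (4 / n) = 1 + K] balances the two terms of [moment_le]. *)
Lemma magnetic_moment_le (L p : R) : (0 < n)%N -> 0 <= L -> 2 <= p ->
  p < 2 + 4 / n%:R ->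
  exists2 c : R, 0 <= c & forall (A : X -> X) u (v : 'I_n -> X -> R[i]) (K : R),
    (forall k, continuous (fun x => A x ord0 k)) -> is_magD A u v -> 0 <= K ->
    (forall k, fine (L2norm (v k)) ^+ 2 <= K) -> fine (L2norm u) ^+ 2 <= L ->
    (\int[leb n]_x (Normc.normc (u x) `^ p)%:E <=
     (c * (1 + K) `^ (n%:R * (p - 2) / 4))%:E)%E.
Proof.
move=> n0 L0 p2; set P := (2 + 4 / n%:R : R) => pP.
have n0' : 0 < n%:R :> R by rewrite ltr0n.
have W0 : 0 <= weak_constant n L by rewrite /weak_constant !mulr_ge0 ?powR_ge0 ?exprn_ge0.
have t0 := tail_constant_ge0 pP.
exists (L + tail_constant p P * (weak_constant n L * 3 `^ P)).
  by rewrite addr_ge0// mulr_ge0// mulr_ge0 ?powR_ge0.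
move=> A u v K cA Duv K0 vK uL.
have [[mur mui ufin] _ _] := Duv.
have mu : cmeasurable u by [].
have K1 : 0 < 1 + K by rewrite ltr_wpDr.
pose lambda := (1 + K) `^ (n%:R / 4).
have l0 : 0 < lambda by rewrite powR_gt0.
pose B := weak_constant n L * 3 `^ P * (1 + K).
have B0 : 0 <= B by rewrite !mulr_ge0 ?powR_ge0// ltW.
have weak t : 0 < t ->
    (leb n [set x | (t < Normc.normc (u x))%R] <= (B * t `^ (- P))%:E)%E.
  (* The weak estimate concerns the level 3 lambda; taking lambda = t / 3 produces the factor
     3^P. *)
  move=> t1; have t3 : 0 < t / 3 by rewrite divr_gt0.
  have := magnetic_weak_type n0 cA Duv K0 L0 t3 vK uL.
  rewrite [3 * _]mulrC divfK// => /le_trans; apply.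
  rewrite lee_fin le_eqVlt; apply/orP; left; apply/eqP.
  rewrite -/P powRM ?(ltW t1) ?invr_ge0//.
  have -> : 3^-1 `^ (- P) = 3 `^ P :> R.
    by rewrite -powR_inv1// -powRrM mulN1r opprK.
  by rewrite /B; ring.
have fL : (\int[leb n]_x (Normc.normc (u x) ^+ 2)%:E <= L%:E)%E.
  by rewrite integral_sqr_normc// lee_fin.
have := moment_le (cmeasurable_normc mu) (fun x => normc_ge0 _) p2 pP B0 l0 fL weak.
move=> /le_trans; apply; rewrite lee_fin le_eqVlt; apply/orP; left; apply/eqP.
have -> : lambda `^ (p - 2) = (1 + K) `^ (n%:R * (p - 2) / 4).
  by rewrite /lambda -powRrM; congr (_ `^ _); field.
have E : (1 + K) * lambda `^ (p - P) = (1 + K) `^ (n%:R * (p - 2) / 4).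
  rewrite /lambda -powRrM -[X in X * _]powRr1 ?(ltW K1)// -powRD; last first.
    by apply/implyP => _; rewrite gt_eqF.
  by congr (_ `^ _); rewrite /P; field; rewrite gt_eqF.
rewrite mulrDl -E /B; ring.
Qed.

End magnetic_moments.

(** * Young's convolution inequality *)

Section convolution.
Context {R : realType} (n : nat).
Local Notation X := 'rV[R]_n.
Local Notation mu2 := (leb n \x leb n)%E.

Lemma measurable_diff : measurable_fun setT (fun p : X * X => p.1 - p.2).
Proof.
apply: measurable_fun_rV => i; under eq_fun do rewrite !mxE.
apply: measurable_funB.
  by apply: (measurableT_comp (measurable_coord i)); exact: measurable_fst.
by apply: (measurableT_comp (measurable_coord i)); exact: measurable_snd.
Qed.

Variables (W f g : X -> \bar R).
Hypotheses (mW : measurable_fun setT W) (mf : measurable_fun setT f)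
  (mg : measurable_fun setT g) (W0 : forall x, (0 <= W x)%E)
  (f0 : forall x, (0 <= f x)%E) (g0 : forall x, (0 <= g x)%E)
  (Weven : forall x, W (- x) = W x).

Let mf1 : measurable_fun setT (fun p : X * X => f p.1).
Proof. exact: (measurableT_comp mf (@measurable_fst _ _ X X)). Qed.

Let mf2 : measurable_fun setT (fun p : X * X => f p.2).
Proof. exact: (measurableT_comp mf (@measurable_snd _ _ X X)). Qed.

Let mg2 : measurable_fun setT (fun p : X * X => g p.2).
Proof. exact: (measurableT_comp mg (@measurable_snd _ _ X X)). Qed.

Let mWd : measurable_fun setT (fun p : X * X => W (p.1 - p.2)).
Proof. exact: (measurableT_comp mW measurable_diff). Qed.

(** This integral and the two convolution integrals below are what the three terms of
    [young_pointwise] become after integration in (x, y). *)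
Lemma integral_tensor :
  (\int[mu2]_p (f p.1 * g p.2) = \int[leb n]_x f x * \int[leb n]_x g x)%E.
Proof.
have m : measurable_fun setT (fun p : X * X => (f p.1 * g p.2)%E).
  exact: emeasurable_funM.
rewrite (fubini_tonelli1 (fun p : X * X => (f p.1 * g p.2)%E) m); last first.
  by move=> p; rewrite mule_ge0.
rewrite /fubini_F /=.
have E x : (\int[leb n]_y (f x * g y) = f x * \int[leb n]_y g y)%E.
  exact: (ge0_integralZl (leb n) measurableT mg (fun y _ => g0 y) (f0 x)).
under eq_integral do rewrite E.
exact: (ge0_integralZr (leb n) measurableT mf (fun y _ => f0 y)
  (integral_ge0 _ (fun y _ => g0 y))).
Qed.

Let int_shift x : (\int[leb n]_y W (y - x)%R = \int[leb n]_y W y)%E.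
Proof. exact: (@integral_shift R n (- x) W mW W0). Qed.

Let IW0 : (0 <= \int[leb n]_y W y)%E. Proof. exact: integral_ge0. Qed.

Let mW_shift x : measurable_fun setT (fun y : X => W (y - x)).
Proof. exact: (measurableT_comp mW (@measurable_rV_shift R n (- x))). Qed.

Lemma integral_conv2 :
  (\int[mu2]_p (W (p.1 - p.2)%R * f p.2) = \int[leb n]_x W x * \int[leb n]_x f x)%E.
Proof.
have m : measurable_fun setT (fun p : X * X => (W (p.1 - p.2)%R * f p.2)%E).
  exact: emeasurable_funM.
rewrite (fubini_tonelli2 (fun p : X * X => (W (p.1 - p.2)%R * f p.2)%E) m); last first.
  by move=> p; rewrite mule_ge0.
rewrite /fubini_G /=.
have E y : (\int[leb n]_x (W (x - y)%R * f y) = \int[leb n]_x W x * f y)%E.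
  rewrite -(int_shift y).
  exact: (ge0_integralZr (leb n) measurableT (mW_shift y) (fun x _ => W0 _) (f0 y)).
under eq_integral do rewrite E.
exact: (ge0_integralZl (leb n) measurableT mf (fun y _ => f0 y) IW0).
Qed.

Lemma integral_conv1 :
  (\int[mu2]_p (W (p.1 - p.2)%R * f p.1) = \int[leb n]_x W x * \int[leb n]_x f x)%E.
Proof.
have m : measurable_fun setT (fun p : X * X => (W (p.1 - p.2)%R * f p.1)%E).
  exact: emeasurable_funM.
rewrite (fubini_tonelli1 (fun p : X * X => (W (p.1 - p.2)%R * f p.1)%E) m); last first.
  by move=> p; rewrite mule_ge0.
rewrite /fubini_F /=.
have E x : (\int[leb n]_y (W (x - y)%R * f x) = \int[leb n]_x W x * f x)%E.
  have W' y : W (x - y) = W (y - x) by rewrite -Weven opprB.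
  rewrite -(int_shift x); under eq_integral do rewrite W'.
  exact: (ge0_integralZr (leb n) measurableT (mW_shift x) (fun y _ => W0 _) (f0 x)).
under eq_integral do rewrite E.
exact: (ge0_integralZl (leb n) measurableT mf (fun y _ => f0 y) IW0).
Qed.

End convolution.

Section young.
Context {R : realType}.

(* Weighted AM-GM with weights 1 - 1/q, 1/(2q), 1/(2q), in logarithms. *)
Lemma young_pointwise (q r w a b kappa : R) : 1 < q -> r = 2 * q / (2 * q - 1) ->
  0 <= w -> 0 <= a -> 0 <= b -> 0 < kappa ->
  w * a * b <= kappa * (a `^ r * b `^ r) +
    (kappa `^ (1 - q) * (w `^ q * a `^ r) + kappa `^ (1 - q) * (w `^ q * b `^ r)).
Proof.
move=> q1 rE w0 a0 b0 k0.
have s0 : 0 <= kappa * (a `^ r * b `^ r) by rewrite mulr_ge0 ?(ltW k0)// mulr_ge0 ?powR_ge0.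
have s1 : 0 <= kappa `^ (1 - q) * (w `^ q * a `^ r).
  by rewrite mulr_ge0 ?powR_ge0// mulr_ge0 ?powR_ge0.
have s2 : 0 <= kappa `^ (1 - q) * (w `^ q * b `^ r).
  by rewrite mulr_ge0 ?powR_ge0// mulr_ge0 ?powR_ge0.
have s : 0 <= kappa * (a `^ r * b `^ r) +
    (kappa `^ (1 - q) * (w `^ q * a `^ r) + kappa `^ (1 - q) * (w `^ q * b `^ r)).
  by rewrite addr_ge0// addr_ge0.
have [wz|wn0] := eqVneq w 0; first by move: s; rewrite wz !mul0r.
have [az|an0] := eqVneq a 0; first by move: s; rewrite az mulr0 mul0r.
have [bz|bn0] := eqVneq b 0; first by move: s; rewrite bz mulr0.
have {}w0 : 0 < w by rewrite lt_def wn0.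
have {}a0 : 0 < a by rewrite lt_def an0.
have {}b0 : 0 < b by rewrite lt_def bn0.
have pE (x y : R) : 0 < x -> x `^ y = expR (y * ln x) by move=> x0; rewrite /powR gt_eqF.
have eE (x : R) : 0 < x -> x = expR (ln x) by move=> x0; rewrite lnK// posrE.
rewrite {1}(eE w)// {1}(eE a)// {1}(eE b)// -!expRD.
move: s0 s1 s2; rewrite !pE// {1 4}(eE kappa)// -!expRD.
set lw := ln w; set la := ln a; set lb := ln b; set lk := ln kappa => s0 s1 s2.
(* The product w a b is a weighted geometric mean of the three terms, so it is at most one of them,
   and all three are nonnegative. The identity [E] below excludes its exceeding all three. *)
have [h|h1] := leP (lw + la + lb) (lk + (r * la + r * lb)).
  by apply: (@le_trans _ _ (expR (lk + (r * la + r * lb)))); 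
    [rewrite ler_expR|rewrite lerDl addr_ge0].
have [h|h2] := leP (lw + la + lb) ((1 - q) * lk + (q * lw + r * la)).
  apply: (@le_trans _ _ (expR ((1 - q) * lk + (q * lw + r * la)))); first by rewrite ler_expR.
  lra.
have [h|h3] := leP (lw + la + lb) ((1 - q) * lk + (q * lw + r * lb)).
  apply: (@le_trans _ _ (expR ((1 - q) * lk + (q * lw + r * lb)))); first by rewrite ler_expR.
  lra.
exfalso.
have E : (1 - q^-1) * (lk + (r * la + r * lb)) +
   (2 * q)^-1 * ((1 - q) * lk + (q * lw + r * la)) +
   (2 * q)^-1 * ((1 - q) * lk + (q * lw + r * lb)) = lw + la + lb.
  by rewrite rE; field; rewrite !gt_eqF//; lra.
have q0 : 0 < q by rewrite (lt_trans _ q1).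
have c1 : 0 < 1 - q^-1 by rewrite subr_gt0 invf_lt1.
have c2 : 0 < (2 * q)^-1 by rewrite invr_gt0 mulr_gt0.
have E1 T : (1 - q^-1) * T + (2 * q)^-1 * T + (2 * q)^-1 * T = T.
  by field; rewrite gt_eqF.
have p1 := h1; rewrite -(ltr_pM2l c1) in p1.
have p2 := h2; rewrite -(ltr_pM2l c2) in p2.
have p3 := h3; rewrite -(ltr_pM2l c2) in p3.
have := E1 (lw + la + lb); lra.
Qed.

Variable n : nat.
Local Notation X := 'rV[R]_n.

(** Where w <= 1 the integrand is at most a(x) b(y), whence S1^2. Where w > 1, [young_pointwise] is
    integrated; its free parameter replaces the use of Hoelder's inequality. *)
Lemma young_convolution (q : R) (w a b : X -> R) (Cw S1 S : R) : 1 < q ->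
  measurable_fun setT w -> measurable_fun setT a -> measurable_fun setT b ->
  (forall x, 0 <= w x) -> (forall x, 0 <= a x) -> (forall x, 0 <= b x) ->
  (forall x, w (- x) = w x) ->
  0 <= Cw -> 0 <= S1 -> 0 < S ->
  (\int[leb n]_x (w x `^ q * \1_[set x | (1 < w x)%R] x)%:E <= Cw%:E)%E ->
  (\int[leb n]_x (a x)%:E <= S1%:E)%E -> (\int[leb n]_x (b x)%:E <= S1%:E)%E ->
  (\int[leb n]_x (a x `^ (2 * q / (2 * q - 1)))%:E <= S%:E)%E ->
  (\int[leb n]_x (b x `^ (2 * q / (2 * q - 1)))%:E <= S%:E)%E ->
  (\int[leb n]_x \int[leb n]_y (w (x - y)%R * a x * b y)%:E <=
   (S1 ^+ 2 + (1 + 2 * Cw) * S `^ (2 - q^-1))%:E)%E.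
Proof.
move=> q1 mw ma mb w0 a0 b0 weven Cw0 S10 S0 hw ha hb har hbr.
set r := 2 * q / (2 * q - 1) in har hbr.
(* This value balances kappa S^2 against kappa^(1-q) S: both equal S^(2 - 1/q). *)
pose kappa := S `^ (- q^-1); pose k' := kappa `^ (1 - q).
have k0 : 0 < kappa by rewrite powR_gt0.
have k'0 : 0 <= k' by exact: powR_ge0.
pose W x : \bar R := (w x `^ q * \1_[set x | (1 < w x)%R] x)%:E.
pose fa x : \bar R := (a x)%:E; pose fb x : \bar R := (b x)%:E.
pose ar x : \bar R := (a x `^ r)%:E; pose br x : \bar R := (b x `^ r)%:E.
have mW : measurable_fun setT W.
  apply/measurable_EFinP; apply: measurable_funM.
    by apply: (measurableT_comp (measurable_powR q)).
  by apply: measurable_indic; exact: measurable_superlevel.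
have mfa : measurable_fun setT fa by exact/measurable_EFinP.
have mfb : measurable_fun setT fb by exact/measurable_EFinP.
have mar : measurable_fun setT ar.
  by apply/measurable_EFinP; apply: (measurableT_comp (measurable_powR r)).
have mbr : measurable_fun setT br.
  by apply/measurable_EFinP; apply: (measurableT_comp (measurable_powR r)).
have W0 x : (0 <= W x)%E by rewrite lee_fin mulr_ge0// powR_ge0.
have fa0 x : (0 <= fa x)%E by rewrite lee_fin.
have fb0 x : (0 <= fb x)%E by rewrite lee_fin.
have ar0 x : (0 <= ar x)%E by rewrite lee_fin powR_ge0.
have br0 x : (0 <= br x)%E by rewrite lee_fin powR_ge0.
have Weven x : W (- x) = W x.
  rewrite /W weven; congr ((_ * _)%:E); rewrite !indicE; congr ((nat_of_bool _)%:R).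
  by apply/idP/idP; rewrite !inE/= weven.
have m1 (f : X -> \bar R) : measurable_fun setT f ->
    measurable_fun setT (fun p : X * X => f p.1).
  by move=> mf; exact: (measurableT_comp mf (@measurable_fst _ _ X X)).
have m2 (f : X -> \bar R) : measurable_fun setT f ->
    measurable_fun setT (fun p : X * X => f p.2).
  by move=> mf; exact: (measurableT_comp mf (@measurable_snd _ _ X X)).
have md (f : X -> \bar R) : measurable_fun setT f ->
    measurable_fun setT (fun p : X * X => f (p.1 - p.2)).
  by move=> mf; exact: (measurableT_comp mf (@measurable_diff R n)).
pose T1 (p : X * X) := (fa p.1 * fb p.2)%E.
pose T2 (p : X * X) := (kappa%:E * (ar p.1 * br p.2))%E.
pose T3 (p : X * X) := (k'%:E * (W (p.1 - p.2)%R * ar p.1))%E.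
pose T4 (p : X * X) := (k'%:E * (W (p.1 - p.2)%R * br p.2))%E.
have T10 p : (0 <= T1 p)%E by rewrite mule_ge0.
have T20 p : (0 <= T2 p)%E by apply: mule_ge0; [rewrite lee_fin ltW|exact: mule_ge0].
have T30 p : (0 <= T3 p)%E by apply: mule_ge0; [rewrite lee_fin|exact: mule_ge0].
have T40 p : (0 <= T4 p)%E by apply: mule_ge0; [rewrite lee_fin|exact: mule_ge0].
have mu2 : measurable_fun setT (fun p : X * X => (ar p.1 * br p.2)%E).
  by apply: emeasurable_funM; [exact: m1|exact: m2].
have mu3 : measurable_fun setT (fun p : X * X => (W (p.1 - p.2)%R * ar p.1)%E).
  by apply: emeasurable_funM; [exact: md|exact: m1].
have mu4 : measurable_fun setT (fun p : X * X => (W (p.1 - p.2)%R * br p.2)%E).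
  by apply: emeasurable_funM; [exact: md|exact: m2].
have mT1 : measurable_fun setT T1.
  by apply: emeasurable_funM; [exact: m1|exact: m2].
have mT2 : measurable_fun setT T2 by exact: measurable_funeM.
have mT3 : measurable_fun setT T3 by exact: measurable_funeM.
have mT4 : measurable_fun setT T4 by exact: measurable_funeM.
pose F (p : X * X) : \bar R := (w (p.1 - p.2) * a p.1 * b p.2)%:E.
have F0 p : (0 <= F p)%E by rewrite lee_fin !mulr_ge0.
have mF : measurable_fun setT F.
  apply/measurable_EFinP; apply: measurable_funM; first apply: measurable_funM.
  - exact: (measurableT_comp mw (@measurable_diff R n)).
  - exact: (measurableT_comp ma (@measurable_fst _ _ X X)).
  - exact: (measurableT_comp mb (@measurable_snd _ _ X X)).
have -> : (\int[leb n]_x \int[leb n]_y (w (x - y)%R * a x * b y)%:E =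
    \int[(leb n \x leb n)%E]_p F p)%E.
  by rewrite (fubini_tonelli1 F mF F0).
apply: (@le_trans _ _ (\int[(leb n \x leb n)%E]_p (T1 p + (T2 p + (T3 p + T4 p))))%E).
  apply: ge0_le_integral => //.
    by repeat (apply: emeasurable_funD => //).
  move=> p _; rewrite /F /T1 /T2 /T3 /T4 /W /ar /br /fa /fb -!EFinM -!EFinD lee_fin.
  have A0 := a0 p.1; have B0 := b0 p.2; have V0 := w0 (p.1 - p.2).
  rewrite indicE; have [w1|w1] := ltP 1 (w (p.1 - p.2)).
    rewrite mem_set// mulr1; apply: le_trans (young_pointwise q1 erefl V0 A0 B0 k0) _.
    by rewrite lerDr mulr_ge0.
  rewrite memNset; last by apply/negP; rewrite -leNgt.
  rewrite !mulr0 !mul0r !mulr0 !addr0 -mulrA.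
  apply: (@le_trans _ _ (a p.1 * b p.2)).
    by rewrite ler_piMl ?mulr_ge0.
  by rewrite lerDl mulr_ge0 ?(ltW k0)// mulr_ge0 ?powR_ge0.
have p34 p : (0 <= T3 p + T4 p)%E by exact: adde_ge0.
have p234 p : (0 <= T2 p + (T3 p + T4 p))%E by exact: adde_ge0.
have q34 : measurable_fun setT (fun p => T3 p + T4 p)%E by exact: emeasurable_funD.
have q234 : measurable_fun setT (fun p => T2 p + (T3 p + T4 p))%E by exact: emeasurable_funD.
rewrite (ge0_integralD (leb n \x leb n)%E measurableT
  (fun p _ => T10 p) mT1 (fun p _ => p234 p) q234).
rewrite (ge0_integralD (leb n \x leb n)%E measurableT
  (fun p _ => T20 p) mT2 (fun p _ => p34 p) q34).
rewrite (ge0_integralD (leb n \x leb n)%E measurableT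
  (fun p _ => T30 p) mT3 (fun p _ => T40 p) mT4).
rewrite (ge0_integralZl_EFin (leb n \x leb n)%E measurableT _ mu2 (ltW k0)); last first.
  by move=> p _; exact: mule_ge0.
rewrite (ge0_integralZl_EFin (leb n \x leb n)%E measurableT _ mu3 k'0); last first.
  by move=> p _; exact: mule_ge0.
rewrite (ge0_integralZl_EFin (leb n \x leb n)%E measurableT _ mu4 k'0); last first.
  by move=> p _; exact: mule_ge0.
rewrite !integral_tensor// integral_conv1// integral_conv2//.
have i0 (f : X -> \bar R) : (forall x, (0 <= f x)%E) -> (0 <= \int[leb n]_x f x)%E.
  by move=> f0; exact: integral_ge0.
apply: (@le_trans _ _ ((S1 * S1)%:E + ((kappa * (S * S))%:E +
    ((k' * (Cw * S))%:E + (k' * (Cw * S))%:E)))%E).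
  apply: leeD; first by rewrite EFinM; apply: lee_pmul => //; exact: i0.
  apply: leeD.
    rewrite EFinM; apply: lee_wpmul2l; first by rewrite lee_fin ltW.
    by rewrite EFinM; apply: lee_pmul => //; exact: i0.
  apply: leeD; rewrite EFinM; apply: lee_wpmul2l; rewrite ?lee_fin//;
    by rewrite EFinM; apply: lee_pmul => //; exact: i0.
rewrite -!EFinD lee_fin le_eqVlt; apply/orP; left; apply/eqP.
have Sn0 : forall s : R, (s == 0) ==> (S != 0) by move=> s; apply/implyP => _; rewrite gt_eqF.
have E1 : kappa * (S * S) = S `^ (2 - q^-1).
  by rewrite addrC powRD// -/kappa powR_mulrn ?(ltW S0)// expr2.
have E2 : k' * S = S `^ (2 - q^-1).
  rewrite /k' /kappa -powRrM -[X in _ * X]powRr1 ?(ltW S0)// -powRD//.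
  by congr (_ `^ _); field; rewrite gt_eqF// (lt_trans _ q1).
by rewrite [k' * (Cw * S)]mulrCA E1 E2; ring.
Qed.

End young.

(** * The terms of the energy *)

Section upper_integral.
Context d (T : measurableType d) (R : realType) (mu : {measure set T -> \bar R}).

(* [f] need not be measurable: the integral is then a lower integral. *)
Lemma integral_le_off_null (f g : T -> \bar R) (Z : set T) : measurable Z ->
  mu Z = 0%E -> measurable_fun setT g -> (forall x, 0 <= g x)%E ->
  (forall x, ~ Z x -> (f x <= g x)%E) -> (\int[mu]_x f x <= \int[mu]_x g x)%E.
Proof.
move=> mZ Z0 mg g0 fg.
(* Being +oo on Z, [gZ] dominates f everywhere without changing the integral of g. Every simple
   function below f^+ is then below [gZ]. *)
pose gZ x := (g x + +oo * (\1_Z x)%:E)%E.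
have mZ1 : measurable_fun setT (fun x => (\1_Z x)%:E : \bar R).
  by apply/measurable_EFinP; exact: measurable_indic.
have Z10 x : (0 <= (\1_Z x)%:E :> \bar R)%E by rewrite lee_fin.
have gZ0 x : (0 <= gZ x)%E by rewrite adde_ge0// mule_ge0.
have <- : (\int[mu]_x gZ x = \int[mu]_x g x)%E.
  rewrite ge0_integralD//; last exact: measurable_funeM.
  by rewrite ge0_integralZl// integral_indic// setIT Z0 mule0 adde0.
apply: (@le_trans _ _ (\int[mu]_x (f^\+ x))%E).
  rewrite integralE -[leRHS]adde0; apply: leeD => //.
  by rewrite oppe_le0; exact: integral_ge0.
rewrite !ge0_integralTE//.
apply: ereal_sup_le => _ [h /= hf <-]; exists h => //= x.
apply: le_trans (hf x) _; rewrite /gZ indicE.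
have [Zx|Zx] := pselect (Z x).
  by rewrite mem_set// mule1 addey ?leey// gt_eqF// (lt_le_trans _ (g0 x)).
by rewrite memNset// mule0 adde0 funeposE ge_max fg// g0.
Qed.

End upper_integral.

Section sublinear.
Context {R : realType}.

(** [fine] sends both infinities to 0; nonnegativity of B covers the case of minus infinity. *)
Lemma fine_le (x : \bar R) (B : R) : 0 <= B -> (x <= B%:E)%E -> fine x <= B.
Proof. by case: x => [r||]//= B0; rewrite ?lee_fin// leye_eq. Qed.

Lemma powR_sublinear (c sigma e : R) : 0 <= c -> 0 <= sigma -> sigma < 1 -> 0 < e ->
  exists2 C, 0 <= C & forall K, 0 <= K -> c * (1 + K) `^ sigma <= e * K + C.
Proof.
move=> c0 s0 s1 e0.
(* The threshold M solves (c + 1) M^sigma = e M: beyond it the linear term wins, below it a constant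
   suffices. Using c + 1 keeps the denominator positive when c = 0. *)
pose M := (e / (c + 1)) `^ (sigma - 1)^-1.
have c1 : 0 < c + 1 by rewrite ltr_wpDl.
have ec : 0 < e / (c + 1) by rewrite divr_gt0.
have M0 : 0 < M by rewrite powR_gt0.
have ME : M `^ sigma = e / (c + 1) * M.
  have -> : e / (c + 1) = M `^ (sigma - 1).
    by rewrite /M -powRrM mulVf ?powRr1 ?(ltW ec)// subr_eq0 lt_eqF.
  by rewrite -{3}[M]powRr1 ?(ltW M0)// -powRD ?subrK//; apply/implyP => _; rewrite gt_eqF.
have Ms : 0 <= M `^ sigma by exact: powR_ge0.
exists (e + (c + 1) * M `^ sigma); first by rewrite addr_ge0 ?(ltW e0)// mulr_ge0// ltW.
move=> K K0.
have Y0 : 0 <= 1 + K by rewrite addr_ge0.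
have le1 : c * (1 + K) `^ sigma <= (c + 1) * (1 + K) `^ sigma.
  by rewrite ler_wpM2r ?powR_ge0// lerDl.
apply: (le_trans le1).
have [YM|MY] := leP (1 + K) M.
  have : (1 + K) `^ sigma <= M `^ sigma by rewrite ge0_ler_powR ?nnegrE// ltW.
  rewrite -(ler_pM2l c1); have : 0 <= e * K by rewrite mulr_ge0// ltW.
  lra.
have Y1 : 1 <= (1 + K) / M by rewrite ler_pdivlMr// mul1r ltW.
have : ((1 + K) / M) `^ sigma <= ((1 + K) / M) `^ 1 by rewrite ler_powR// ltW.
rewrite powRr1 ?divr_ge0 ?(ltW M0)// powRM ?invr_ge0 ?(ltW M0)// => h.
have : (1 + K) `^ sigma <= e / (c + 1) * (1 + K).
  have {}h : (1 + K) `^ sigma * M^-1 `^ sigma * M `^ sigma <= (1 + K) / M * M `^ sigma.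
    by rewrite ler_wpM2r.
  have E1 : M^-1 `^ sigma * M `^ sigma = 1.
    by rewrite -powRM ?invr_ge0 ?(ltW M0)// mulVf ?gt_eqF// powR1.
  move: h; rewrite -mulrA E1 mulr1 ME.
  have -> : (1 + K) / M * (e / (c + 1) * M) = e / (c + 1) * (1 + K); last by [].
  by field; rewrite !gt_eqF.
rewrite -(ler_pM2l c1).
have -> : (c + 1) * (e / (c + 1) * (1 + K)) = e * (1 + K) by field; rewrite gt_eqF.
have : 0 <= (c + 1) * M `^ sigma by rewrite mulr_ge0// ltW.
lra.
Qed.

End sublinear.

Section euclidean_norm.
Context {R : realType} (n : nat).
Local Notation X := 'rV[R]_n.

Lemma enorm_ge0 (x : X) : 0 <= enorm x.
Proof. exact: sqrtr_ge0. Qed.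

Lemma enormN (x : X) : enorm (- x) = enorm x.
Proof. by congr Num.sqrt; apply: eq_bigr => i _; rewrite mxE sqrrN. Qed.

Lemma enorm_gt0 (x : X) : x != 0 -> 0 < enorm x.
Proof.
move=> x0; rewrite sqrtr_gt0 lt_def sumr_ge0 ?andbT; last by move=> i _; exact: sqr_ge0.
apply: contra x0 => /eqP/psumr_eq0P h; apply/eqP/rowP => i; rewrite mxE.
have /eqP := h (fun i _ => sqr_ge0 _) i isT; by rewrite sqrf_eq0 => /eqP.
Qed.

Let set1_box : [set (0 : X)] =
  [set x | forall i, x ord0 i \in `[(0 : X) ord0 i, (0 : X) ord0 i]].
Proof.
apply/seteqP; split=> x /=; first by move=> -> i; rewrite in_itv/= lexx.
move=> h; apply/rowP => i; apply/eqP; rewrite eq_le.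
by have := h i; rewrite in_itv/= andbC.
Qed.

(** The bound on G is assumed for r > 0 only, so the origin has to be discarded. In dimension 0 the
    measure is a Dirac mass and this would fail. *)
Lemma leb_set1 : (0 < n)%N -> leb n [set (0 : X)] = 0%E.
Proof.
move=> n0; rewrite set1_box leb_box//; case: n n0 => // k _.
by rewrite big_ord_recl subrr mul0r.
Qed.

Lemma measurable_set1_rV : measurable [set (0 : X)].
Proof. rewrite set1_box; exact: measurable_box. Qed.

End euclidean_norm.

Section energy_terms.
Context {R : realType} (n : nat).
Local Notation X := 'rV[R]_n.
Hypothesis n0 : (0 < n)%N.
Let nR0 : 0 < n%:R :> R.
Proof. by rewrite ltr0n. Qed.

(** This is all that the estimates use of a component of the solution: the bounds below are uniform
    over such u, with C chosen before K. *)
Definition bounded_state (A : X -> X) (L K : R) (u : X -> R[i]) :=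
  exists v : 'I_n -> X -> R[i], [/\ is_magD A u v,
    forall k, fine (L2norm (v k)) ^+ 2 <= K & fine (L2norm u) ^+ 2 <= L].

Lemma bounded_state_cmeasurable A L K u : bounded_state A L K u -> cmeasurable u.
Proof. by move=> [v [[[? ? _] _ _] _ _]]. Qed.

Lemma bounded_state_mass A L K u : bounded_state A L K u ->
  (\int[leb n]_x (Normc.normc (u x) ^+ 2)%:E <= L%:E)%E.
Proof.
by move=> [v [[[_ _ ufin] _ _] _ uL]]; rewrite integral_sqr_normc// lee_fin.
Qed.

Variables (A : X -> X) (L : R).
Hypotheses (cA : forall k, continuous (fun x => A x ord0 k)) (L0 : 0 <= L).

Lemma subcritical_moment_le (p e : R) : 2 <= p -> p < 2 + 4 / n%:R -> 0 < e ->
  exists2 C, 0 <= C & forall (u : X -> R[i]) K, 0 <= K -> bounded_state A L K u ->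
    (\int[leb n]_x (Normc.normc (u x) `^ p)%:E <= (e * K + C)%:E)%E.
Proof.
move=> p2 pP e0; have [c c0 hc] := magnetic_moment_le n0 L0 p2 pP.
have s0 : 0 <= n%:R * (p - 2) / 4 by rewrite !mulr_ge0// subr_ge0.
have s1 : n%:R * (p - 2) / 4 < 1.
  rewrite ltr_pdivrMr// mul1r mulrC -ltr_pdivlMr//; lra.
have [C C0 hC] := powR_sublinear c0 s0 s1 e0; exists C => // u K K0 [v [Duv vK uL]].
by apply: le_trans (hc _ _ _ _ cA Duv K0 vK uL) _; rewrite lee_fin hC.
Qed.

Section hartree.
Variables (w h : R -> R) (q mu : R).
Hypotheses (w0 : forall r, 0 <= r -> 0 <= w r)
  (weakw : weakL q (fun x : X => w (enorm x))) (q1 : 1 < q)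
  (h0 : forall s, 0 <= s -> 0 <= h s)
  (h_mono : forall r s, 0 <= r -> r <= s -> h r <= h s)
  (mu2 : 2 <= mu) (mu_lt : mu < 2 - 1 / q + 2 / n%:R).

Lemma measurable_comp_normc (u : X -> R[i]) : cmeasurable u ->
  measurable_fun setT (fun x => h (Normc.normc (u x))).
Proof.
(* Monotonicity of h is known on the half-line only; truncating the argument at 0 gives a function
   monotone on all of R, hence measurable. *)
move=> mu_; pose h' t := h (Num.max 0 t).
have -> : (fun x => h (Normc.normc (u x))) = h' \o (fun x => Normc.normc (u x)).
  by apply/funext => x; rewrite /h' /= max_r// normc_ge0.
apply: measurableT_comp; last exact: cmeasurable_normc.
apply: nondecreasing_measurable => // s t st; apply: h_mono; first by rewrite le_max lexx.
by rewrite ge_max le_max lexx /= le_max st orbT.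
Qed.

(* [1 / q1] is chosen strictly between [1 / q] and [min 1 (2 + 2 / n - mu)]. *)
Lemma exists_young_exponent : exists q1 : R,
  [/\ 1 < q1, q1 < q & mu < 2 - q1^-1 + 2 / n%:R].
Proof.
have q0 : 0 < q by rewrite (lt_trans _ q1).
pose s := (q^-1 + Num.min 1 (2 + 2 / n%:R - mu)) / 2.
have sq : q^-1 < Num.min 1 (2 + 2 / n%:R - mu).
  by rewrite lt_min invf_lt1// q1/=; move: mu_lt; rewrite div1r; lra.
have s1 : s < 1.
  have : Num.min 1 (2 + 2 / n%:R - mu) <= 1 by rewrite ge_min lexx.
  by rewrite /s; lra.
have s2 : s < 2 + 2 / n%:R - mu.
  have : Num.min 1 (2 + 2 / n%:R - mu) <= 2 + 2 / n%:R - mu by rewrite ge_min lexx orbT.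
  by rewrite /s; lra.
have qs : q^-1 < s by rewrite /s; lra.
have s0 : 0 < s by rewrite (lt_trans _ qs)// invr_gt0.
exists s^-1; rewrite invrK; split.
- by rewrite invf_gt1.
- by rewrite -[q]invrK ltf_pV2 ?posrE// invr_gt0.
- lra.
Qed.

Variable D : R.
Hypotheses (D0 : 0 < D) (hD : forall s, 0 <= s -> h s <= D * s `^ mu).

Lemma integral_comp_powR_le (r : R) : 1 <= r -> mu * r < 2 + 4 / n%:R ->
  exists2 c, 0 < c & forall (u : X -> R[i]) K, 0 <= K -> bounded_state A L K u ->
    (\int[leb n]_x (h (Normc.normc (u x)) `^ r)%:E <=
     (c * (1 + K) `^ (n%:R * (mu * r - 2) / 4))%:E)%E.
Proof.
move=> r1 mr.
have r0 : 0 <= r by rewrite (le_trans _ r1).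
have m2 : 2 <= mu * r by rewrite (le_trans mu2)// ler_peMr// (le_trans _ mu2).
have [c c0 hc] := magnetic_moment_le n0 L0 m2 mr.
(* The constant is made positive by c + 1, because [young_convolution] requires 0 < S. *)
exists (D `^ r * (c + 1)); first by rewrite mulr_gt0 ?powR_gt0// ltr_wpDl.
move=> u K K0 su; have mu_ := bounded_state_cmeasurable su.
have [v [Duv vK uL]] := su.
have mm : measurable_fun setT (fun x => (Normc.normc (u x) `^ (mu * r))%:E).
  apply/measurable_EFinP; apply: (measurableT_comp (measurable_powR (mu * r))).
  exact: cmeasurable_normc.
have p0 x : (0 <= (Normc.normc (u x) `^ (mu * r))%:E)%E by rewrite lee_fin powR_ge0.
apply: (@le_trans _ _ (\int[leb n]_x ((D `^ r)%:E * (Normc.normc (u x) `^ (mu * r))%:E)))%E.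
  apply: ge0_le_integral => //.
  - by move=> x _; rewrite lee_fin powR_ge0.
  - apply/measurable_EFinP; apply: (measurableT_comp (measurable_powR r)).
    exact: measurable_comp_normc.
  - exact: measurable_funeM.
  - move=> x _; rewrite -EFinM lee_fin powRrM -powRM ?powR_ge0 ?(ltW D0)//.
    have nu := normc_ge0 (u x).
    by rewrite ge0_ler_powR ?nnegrE ?h0 ?mulr_ge0 ?powR_ge0 ?(ltW D0) ?hD.
rewrite (ge0_integralZl_EFin (leb n) measurableT (fun x _ => p0 x) mm (powR_ge0 _ _)).
apply: (@le_trans _ _ ((D `^ r)%:E * (c * (1 + K) `^ (n%:R * (mu * r - 2) / 4))%:E))%E.
  by apply: lee_wpmul2l; [rewrite lee_fin powR_ge0|exact: hc cA Duv K0 vK uL].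
rewrite -EFinM lee_fin -[leRHS]mulrA ler_wpM2l ?powR_ge0// ler_wpM2r ?powR_ge0//.
by rewrite lerDl.
Qed.

(** A weak L^q function has finite moments of lower order above any positive level. The absolute
    value of B appears since the sign of the weak constant is not prescribed. *)
Lemma weakL_tail (q' : R) : 1 < q' -> q' < q -> exists2 Cw, 0 <= Cw &
  (\int[leb n]_x (w (enorm x) `^ q' * \1_[set x : X | (1 < w (enorm x))%R] x)%:E
    <= Cw%:E)%E.
Proof.
move=> q'1 q'q; have [mw [B hB]] := weakw.
have q'0 : 0 <= q' by rewrite (le_trans _ (ltW q'1)).
exists (tail_constant q' q * `|B| * 1 `^ (q' - q)).
  by rewrite mulr_ge0 ?powR_ge0// mulr_ge0// tail_constant_ge0.
apply: (tail_moment_le mw (fun x => w0 (enorm_ge0 x)) q'0 q'q) => //.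
move=> t t1; have t0 : 0 < t by rewrite (lt_le_trans _ t1).
have -> : [set x : X | t < w (enorm x)] = [set x | t < `|w (enorm x)|].
  by apply/seteqP; split=> x /=; rewrite ger0_norm// w0// enorm_ge0.
apply: le_trans (hB t t0) _; rewrite lee_fin ler_wpM2r ?powR_ge0// ler_norm//.
Qed.

Lemma hartree_le (e : R) : 0 < e ->
  exists2 C, 0 <= C & forall (u1 u2 : X -> R[i]) K, 0 <= K ->
    bounded_state A L K u1 -> bounded_state A L K u2 ->
    fine (\int[leb n]_x \int[leb n]_y
      (w (enorm (x - y)%R) * h (Normc.normc (u1 x)) * h (Normc.normc (u2 y)))%:E)%E
    <= e * K + C.
Proof.
move=> e0; have [p [p1 pq mp]] := exists_young_exponent.
have p0 : 0 < p by rewrite (lt_trans _ p1).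
have ip : p^-1 < 1 by rewrite invf_lt1.
have ip0 : 0 < p^-1 by rewrite invr_gt0.
have [Cw Cw0 hCw] := weakL_tail p1 pq.
pose r := 2 * p / (2 * p - 1).
have p21 : 0 < 2 * p - 1 by lra.
have r1 : 1 <= r by rewrite ler_pdivlMr//; lra.
have rE : r * (2 - p^-1) = 2 by rewrite /r; field; rewrite !gt_eqF.
have n2 : 0 < 2 / n%:R :> R by rewrite divr_gt0.
have n4 : 4 / n%:R = 2 * (2 / n%:R) :> R by ring.
(* Multiplied by 2 - 1/p, the claim becomes mu < (1 + 2/n)(2 - 1/p); this follows from [mp], since 2
   - 1/p > 1. *)
have mr : mu * r < 2 + 4 / n%:R.
  have c0 : 0 < 2 - p^-1 by lra.
  rewrite -(ltr_pM2r c0) -mulrA rE n4; nra.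
have m1 : mu * 1 < 2 + 4 / n%:R by rewrite mulr1 n4; lra.
have [c1 c10 h1] := integral_comp_powR_le (lexx 1) m1.
have [c2 c20 h2] := integral_comp_powR_le r1 mr.
pose s1 := n%:R * (mu - 2) / 4; pose s2 := n%:R * (mu * r - 2) / 4.
have nE : n%:R * (2 / n%:R) = 2 :> R by rewrite mulrC divfK// gt_eqF.
have s10 : 0 <= s1 * 2 by rewrite !mulr_ge0 ?subr_ge0.
have s11 : s1 * 2 < 1.
  have : n%:R * (mu - 2) < n%:R * (2 / n%:R) by rewrite ltr_pM2l//; lra.
  rewrite nE /s1; lra.
have s2E : s2 * (2 - p^-1) = n%:R * (mu - 2 + p^-1) / 2.
  have -> : s2 * (2 - p^-1) = n%:R * (mu * (r * (2 - p^-1)) - 2 * (2 - p^-1)) / 4.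
    by rewrite /s2; ring.
  by rewrite rE; lra.
have s20 : 0 <= s2 * (2 - p^-1).
  have mp0 : 0 <= mu - 2 + p^-1 by rewrite addr_ge0 ?subr_ge0// ltW.
  by rewrite s2E divr_ge0// mulr_ge0.
have s21 : s2 * (2 - p^-1) < 1.
  have : n%:R * (mu - 2 + p^-1) < n%:R * (2 / n%:R) by rewrite ltr_pM2l//; lra.
  rewrite nE s2E; lra.
have c1sq : 0 <= c1 ^+ 2 by exact: sqr_ge0.
have c2p : 0 <= (1 + 2 * Cw) * c2 `^ (2 - p^-1).
  by rewrite mulr_ge0 ?powR_ge0// addr_ge0// mulr_ge0.
(* Half of e goes to the part w <= 1, half to the part w > 1. *)
have e2 : 0 < e / 2 by rewrite divr_gt0.
have [C1 C10 hC1] := powR_sublinear c1sq s10 s11 e2.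
have [C2 C20 hC2] := powR_sublinear c2p s20 s21 e2.
exists (C1 + C2); first exact: addr_ge0.
move=> u1 u2 K K0 su1 su2.
have K1 : 0 < 1 + K by rewrite ltr_wpDr.
apply: fine_le; first by rewrite addr_ge0 ?addr_ge0// mulr_ge0// ltW.
pose S1 := c1 * (1 + K) `^ s1; pose S := c2 * (1 + K) `^ s2.
have S10 : 0 <= S1 by rewrite mulr_ge0 ?powR_ge0// ltW.
have S0 : 0 < S by rewrite mulr_gt0// powR_gt0.
have hn (u : X -> R[i]) x : 0 <= h (Normc.normc (u x)) by rewrite h0// normc_ge0.
have i1 u : bounded_state A L K u ->
    (\int[leb n]_x (h (Normc.normc (u x)))%:E <= S1%:E)%E.
  move=> su; have := h1 u K K0 su; rewrite mulr1.
  by under eq_integral do rewrite powRr1//.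
have := @young_convolution R n p (fun x => w (enorm x))
  (fun x => h (Normc.normc (u1 x))) (fun x => h (Normc.normc (u2 x))) Cw S1 S p1
  weakw.1 (measurable_comp_normc (bounded_state_cmeasurable su1))
  (measurable_comp_normc (bounded_state_cmeasurable su2))
  (fun x => w0 (enorm_ge0 x)) (hn u1) (hn u2)
  (fun x => congr1 w (enormN x)) Cw0 S10 S0 hCw (i1 _ su1) (i1 _ su2)
  (h2 _ _ K0 su1) (h2 _ _ K0 su2).
move=> /le_trans; apply; rewrite lee_fin.
have E1 : S1 ^+ 2 = c1 ^+ 2 * (1 + K) `^ (s1 * 2).
  by rewrite /S1 exprMn powRrM powR_mulrn ?powR_ge0.
have E2 : S `^ (2 - p^-1) = c2 `^ (2 - p^-1) * (1 + K) `^ (s2 * (2 - p^-1)).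
  by rewrite /S powRM ?powR_ge0 ?(ltW c20)// -powRrM.
rewrite E1 E2 mulrA.
have := hC1 K K0; have := hC2 K K0; lra.
Qed.

End hartree.

Lemma potential_le m (G : R -> ('I_m -> R) -> R) (l : 'I_m -> R) (e : R) :
  assG G l -> (forall j, 0 < l j /\ l j < 4 / n%:R) -> 0 < e ->
  exists2 C, 0 <= C & forall (Phi : 'I_m -> X -> R[i]) K, 0 <= K ->
    (forall j, bounded_state A L K (Phi j)) ->
    \int[leb n]_x G (enorm x) (sqmod (fun j => Phi j x)) <= e * K + C.
Proof.
move=> [M M0 hG] hl e0.
(* The m components each contribute M e1 K; m + 1 instead of m keeps the denominator nonzero without
   a case distinction. *)
pose e1 := e / (M * m.+1%:R).
have m0 : 0 < m.+1%:R :> R by rewrite ltr0n.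
have Mm : 0 < M * m.+1%:R by rewrite mulr_gt0.
have e10 : 0 < e1 by rewrite divr_gt0.
have /choice[C hC] : forall j, exists C, 0 <= C /\
    forall (u : X -> R[i]) K, 0 <= K -> bounded_state A L K u ->
    (\int[leb n]_x (Normc.normc (u x) `^ (l j + 2))%:E <= (e1 * K + C)%:E)%E.
  move=> j; have [l0 l4] := hl j.
  have h1 : 2 <= l j + 2 by lra.
  have h2 : l j + 2 < 2 + 4 / n%:R by lra.
  by have [C C0 ?] := subcritical_moment_le h1 h2 e10; exists C.
pose B := M * \sum_j (L + C j).
have B0 : 0 <= B.
  by rewrite mulr_ge0 ?(ltW M0)// sumr_ge0// => j _; rewrite addr_ge0//; have [] := hC j.
exists B => // Phi K K0 sPhi.
pose F j x : \bar R :=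
  ((Normc.normc (Phi j x) ^+ 2)%:E + (Normc.normc (Phi j x) `^ (l j + 2))%:E)%E.
have mP j := cmeasurable_normc (bounded_state_cmeasurable (sPhi j)).
have mF1 j : measurable_fun setT (fun x => (Normc.normc (Phi j x) ^+ 2)%:E).
  by apply/measurable_EFinP; apply: measurable_funX; exact: mP.
have mF2 j : measurable_fun setT (fun x => (Normc.normc (Phi j x) `^ (l j + 2))%:E).
  by apply/measurable_EFinP; apply: (measurableT_comp (measurable_powR (l j + 2))); exact: mP.
have mF j : measurable_fun setT (F j) by exact: emeasurable_funD.
have F10 j x : (0 <= (Normc.normc (Phi j x) ^+ 2)%:E)%E by rewrite lee_fin sqr_ge0.
have F20 j x : (0 <= (Normc.normc (Phi j x) `^ (l j + 2))%:E)%E by rewrite lee_fin powR_ge0.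
have F0 j x : (0 <= F j x)%E by exact: adde_ge0.
have mS : measurable_fun setT (fun x => \sum_j F j x)%E by exact: emeasurable_sum.
have S0 x : (0 <= \sum_j F j x)%E by exact: sume_ge0.
apply: fine_le; first by rewrite addr_ge0// mulr_ge0// ltW.
apply: (@le_trans _ _ (\int[leb n]_x (M%:E * \sum_j F j x)))%E.
  apply: (integral_le_off_null (@measurable_set1_rV R n) (@leb_set1 R n n0)).
  - exact: measurable_funeM.
  - by move=> x; rewrite mule_ge0 ?lee_fin ?(ltW M0).
  - move=> x x0; have ex : 0 < enorm x by apply: enorm_gt0; exact/eqP.
    have sq0 i : 0 <= sqmod (fun j => Phi j x) i by exact: sqr_ge0.
    have [_] := hG _ _ ex sq0 => le.
    have -> : (\sum_j F j x = (\sum_j (Normc.normc (Phi j x) ^+ 2 +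
        Normc.normc (Phi j x) `^ (l j + 2)))%:E)%E.
      by rewrite -sumEFin; apply: eq_bigr => j _; rewrite EFinD.
    rewrite -EFinM lee_fin; apply: (le_trans le); rewrite ler_pM2l// big_split/=.
    rewrite lerD2l; apply: ler_sum => j _.
    rewrite /sqmod -powR_mulrn ?normc_ge0// -powRrM.
    by have -> : 2%:R * ((l j + 2) / 2) = l j + 2 by field.
rewrite (ge0_integralZl_EFin (leb n) measurableT (fun x _ => S0 x) mS (ltW M0)).
rewrite ge0_integral_sum//.
apply: (@le_trans _ _ (M%:E * \sum_j (L + (e1 * K + C j))%:E))%E.
  apply: lee_wpmul2l; first by rewrite lee_fin ltW.
  apply: lee_sum => j _; rewrite ge0_integralD// EFinD; apply: leeD.
    exact: bounded_state_mass (sPhi j).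
  by have [_ ] := hC j; apply.
rewrite sumEFin -EFinM lee_fin /B.
have -> : \sum_j (L + (e1 * K + C j)) = \sum_j (L + C j) + e1 * K * m%:R.
  have -> : e1 * K * m%:R = \sum_(j < m) e1 * K by rewrite sumr_const card_ord mulr_natr.
  by rewrite -big_split/=; apply: eq_bigr => j _; ring.
rewrite mulrDr addrC lerD2r.
have -> : e * K = M * (e1 * K * m.+1%:R).
  by rewrite /e1; field; rewrite !gt_eqF.
rewrite ler_pM2l//; apply: ler_wpM2l; last by rewrite ler_nat.
by rewrite mulr_ge0// ltW.
Qed.

End energy_terms.

(** * The a priori bound *)

Section a_priori_bound.
Context {R : realType} (N m : nat).
Local Notation X := 'rV[R]_N.
Local Notation F := ('I_m -> X -> R[i]).
Variables (A : X -> X) (V : X -> R) (W : 'I_m -> 'I_m -> R -> R)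
  (G : R -> ('I_m -> R) -> R) (h : R -> R).

Lemma kinetic_ge0 (Phi : F) : 0 <= kinetic A Phi.
Proof. by apply: sumr_ge0 => j _; apply: sumr_ge0 => k _; exact: sqr_ge0. Qed.

Lemma sqr_l2norm (Phi : F) :
  l2norm Phi ^+ 2 = \sum_j fine (L2norm (Phi j)) ^+ 2.
Proof. by rewrite sqr_sqrtr// sumr_ge0// => j _; exact: sqr_ge0. Qed.

Lemma bounded_state_HA (Phi : F) j : HA A Phi ->
  bounded_state A (l2norm Phi ^+ 2) (kinetic A Phi) (Phi j).
Proof.
move=> /(_ j) [v Hv]; exists (magD A (Phi j)); split.
- by apply: (xgetPex (fun _ => cst 0) (P := is_magD A (Phi j))); exists v.
- move=> k; rewrite /kinetic (bigD1 j)//= (bigD1 k)//= -addrA lerDl addr_ge0//.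
    by apply: sumr_ge0 => i _; exact: sqr_ge0.
  by apply: sumr_ge0 => i _; apply: sumr_ge0 => i' _; exact: sqr_ge0.
- rewrite sqr_l2norm (bigD1 j)//= lerDl.
  by apply: sumr_ge0 => i _; exact: sqr_ge0.
Qed.

Lemma continuous_smooth (f : X -> R) : smooth f -> continuous f.
Proof. by move=> /(_ [::]) []. Qed.

Variables (q mu : R) (l : 'I_m -> R).
Hypotheses (N0 : (0 < N)%N) (hA : assA A) (hW : assW N W q) (hG : assG G l)
  (hh : assh N h q mu) (hl : forall j, 0 < l j /\ l j < 4 / N%:R)
  (hmu : mu < 2 - 1 / q + 2 / N%:R) (V0 : forall x, 0 <= V x).

(** B is chosen before Phi, from mass and energy alone; since both are conserved, the same B serves
    at every time. *)
Lemma hnorm_bound (L E : R) : exists B, forall Phi : F, HA A Phi ->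
  l2norm Phi = L -> energy V W G h A Phi = E -> hnorm A Phi <= B.
Proof.
have [hA1 _] := hA; have [q1 hW1] := hW.
have cA k : continuous (fun x => A x ord0 k) by apply: continuous_smooth; exact: hA1.
have {}q1 : 1 < q by apply: le_lt_trans q1; rewrite le_max lexx.
have [[h0 _ _ hmono _] [_ [D [D1 [D2 [D0 _ _ hD _]]]] mu2 _]] := hh.
have L20 : 0 <= L ^+ 2 by exact: sqr_ge0.
(* In the bound for K the potential G contributes 2 e K and the m^2 Hartree terms e K each; this e
   makes the total K / 2. *)
pose e : R := (2 * (2 + m%:R ^+ 2))^-1.
have M0 : 0 < 2 + m%:R ^+ 2 :> R by rewrite ltr_wpDr// sqr_ge0.
have e0 : 0 < e by rewrite invr_gt0 mulr_gt0.
have [C C0 hC] := potential_le N0 cA L20 hG hl e0.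
have /choice[H hH] : forall ij : 'I_m * 'I_m, exists H, forall (u1 u2 : X -> R[i]) K, 0 <= K ->
    bounded_state A (L ^+ 2) K u1 -> bounded_state A (L ^+ 2) K u2 ->
    fine (\int[leb N]_x \int[leb N]_y
      (W ij.1 ij.2 (enorm (x - y)%R) * h (Normc.normc (u1 x)) * h (Normc.normc (u2 y)))%:E)%E
    <= e * K + H.
  move=> [i j]; have [W0 _ _ weakW _] := hW1 i j.
  have [H _ hH] := hartree_le N0 cA L20 W0 weakW q1 h0 hmono mu2 hmu D0
    (fun s s0 => (hD s s0).1) e0.
  by exists H.
pose Ctot := 2 * E + 2 * C + \sum_i \sum_j H (i, j).
exists (Num.sqrt (2 * Ctot + L ^+ 2)) => Phi HPhi PhiL PhiE.
rewrite /hnorm PhiL ler_wsqrtr// lerD2r.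
set K := kinetic A Phi; have K0 : 0 <= K by exact: kinetic_ge0.
have sPhi j : bounded_state A (L ^+ 2) K (Phi j).
  by rewrite -PhiL; exact: bounded_state_HA.
have VP : 0 <= \int[leb N]_x (V x * \sum_j Normc.normc (Phi j x) ^+ 2).
  apply: Rintegral_ge0 => x _; rewrite mulr_ge0// sumr_ge0// => j _.
  exact: sqr_ge0.
have GP := hC Phi K K0 sPhi.
have WP : \sum_i \sum_j fine (\int[leb N]_x \int[leb N]_y
      (W i j (enorm (x - y)%R) * h (Normc.normc (Phi i x)) * h (Normc.normc (Phi j y)))%:E)%E
    <= e * K * m%:R ^+ 2 + \sum_i \sum_j H (i, j).
  apply: (@le_trans _ _ (\sum_i \sum_j (e * K + H (i, j)))).
    apply: ler_sum => i _; apply: ler_sum => j _.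
    exact: (hH (i, j) _ _ _ K0 (sPhi i) (sPhi j)).
  rewrite le_eqVlt; apply/orP; left; apply/eqP.
  under eq_bigr do rewrite big_split/= sumr_const card_ord.
  by rewrite big_split/= sumr_const card_ord -mulrnA expr2 -natrM mulr_natr.
move: PhiE; rewrite /energy -/K => PhiE.
have eE : e * (2 + m%:R ^+ 2) = 2^-1 by rewrite /e; field; rewrite gt_eqF.
(* Twice the energy identity solved for K; the V term has a favourable sign and is dropped. *)
have : K <= 2 * E + 2 * (e * K + C) + (e * K * m%:R ^+ 2 + \sum_i \sum_j H (i, j)).
  by rewrite -PhiE; lra.
have -> : 2 * E + 2 * (e * K + C) + (e * K * m%:R ^+ 2 + \sum_i \sum_j H (i, j)) =
    e * (2 + m%:R ^+ 2) * K + Ctot by rewrite /Ctot; ring.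
rewrite eE; lra.
Qed.

End a_priori_bound.

(** * Boundedness against the blow-up alternative *)

Lemma bounded_not_cvgy (R : realType) (T : Type) (F : set_system T)
    (FF : ProperFilter F) (f : T -> R) (B : R) (P : set T) :
  F P -> (forall t, P t -> f t <= B) -> ~ (f t @[t --> F] --> +oo).
Proof.
move=> FP fB /cvgryPgt /(_ B) nf.
have [t [Pt ft]] := filter_ex (filterI FP nf).
by have := fB t Pt; rewrite leNgt ft.
Qed.

Theorem theorem3p1 (R : realType) (N m : nat) (hN : (1 <= N)%N) (hm : (1 <= m)%N)
  (A : 'rV[R]_N -> 'rV[R]_N) (V : 'rV[R]_N -> R)
  (g : 'I_m -> R -> ('I_m -> R) -> R) (G : R -> ('I_m -> R) -> R)
  (W : 'I_m -> 'I_m -> R -> R) (h : R -> R)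
  (q mu : R) (l : 'I_m -> R)
  (hA : assA A) (hB : assB A) (hV : assV V) (hW : assW N W q)
  (hg : assg N g) (hpG : potentialG g G) (hG : assG G l) (hh : assh N h q mu)
  (hl : forall j, 0 < l j /\ l j < 4 / N%:R)
  (hmu : mu < 2 - 1 / q + 2 / N%:R)
  (hVinf : 0 < inf (range V))
  (M : R) (hM : 0 < M)
  (Phi0 : 'I_m -> 'rV[R]_N -> R[i]) (hPhi0 : HA A Phi0)
  (hPhi0M : hnorm A Phi0 <= M)
  (Tm Tp : \bar R) (Phi : R -> 'I_m -> 'rV[R]_N -> R[i])
  (hPhi : maximal_solution V g W G h A Phi0 Tm Tp Phi) :
  [/\ Tm = +oo%E, Tp = +oo%E &
      (ereal_sup (range (fun t => (hnorm A (Phi t))%:E)) < +oo)%E].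
Proof.
have V0 x : 0 <= V x.
  (* [inf] takes the default value 0 on sets without an infimum, so its being positive forces V to
     be bounded below. *)
  have hi : has_inf (range V).
    by apply: contrapT => /inf_out i0; move: hVinf; rewrite i0 ltxx.
  by apply: (le_trans (ltW hVinf)); apply: ge_inf; [exact: hi.2|exists x].
have [B hB'] := hnorm_bound hN hA hW hG hh hl hmu V0 (l2norm Phi0) (energy V W G h A Phi0).
have bound t : timeI Tm Tp t -> hnorm A (Phi t) <= B.
  move=> It; apply: hB'.
  - exact: (sol_mem (max_sol hPhi)).
  - exact: (max_charge hPhi).
  - exact: (max_energy hPhi).
have Tm0 := max_Tm hPhi; have Tp0 := max_Tp hPhi.
have Tpoo : Tp = +oo%E.
  apply/eqP; rewrite eq_le leey /= leNgt; apply/negP => Tpfin.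
  have TpE : Tp = (fine Tp)%:E by rewrite fineK// ge0_fin_numE// ltW.
  have Tpr0 : 0 < fine Tp by rewrite -lte_fin -TpE.
  apply: (bounded_not_cvgy _ _ bound (max_blowup_p hPhi Tpfin)).
  near=> t; split.
    apply: (@lt_trans _ _ 0%E); first by rewrite oppe_lt0.
    by rewrite lte_fin; near: t; exact: nbhs_left_gt.
  by rewrite TpE lte_fin; near: t; exact: nbhs_left_lt.
(* With Tp already infinite, times just to the right of -Tm lie in the interval of existence without
   any upper constraint. *)
have Tmoo : Tm = +oo%E.
  apply/eqP; rewrite eq_le leey /= leNgt; apply/negP => Tmfin.
  have TmE : Tm = (fine Tm)%:E by rewrite fineK// ge0_fin_numE// ltW.
  have Tmr0 : 0 < fine Tm by rewrite -lte_fin -TmE.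
  apply: (bounded_not_cvgy _ _ bound (max_blowup_m hPhi Tmfin)).
  near=> t; split.
    by rewrite TmE -EFinN lte_fin; near: t; exact: nbhs_right_gt.
  by rewrite Tpoo ltry.
split => //; apply: (@le_lt_trans _ _ B%:E); last exact: ltry.
apply: ge_ereal_sup => _ [t _ <-]; rewrite lee_fin; apply: bound.
by rewrite Tmoo Tpoo; split; [rewrite ltNyr|rewrite ltry].
Unshelve. all: by end_near. Qed.
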